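(* Any $m\in\mathbb{N}$ can be written as $x^2+y^2+z^2+w^2$ with $x,y,z,w\in\mathbb{N}/13$ such that $x+2y+2z$ is an integer square.
   Context: $\mathbb{N}=\{0,1,2,\ldots\}$; $\mathbb{N}/13=\{k/13: k\in\mathbb{N}\}$; an integer square is an element of $\{t^2: t\in\mathbb{Z}\}$. *)

(* Defs.v *)
From mathcomp Require Import all_boot all_order all_algebra.

Set Implicit Arguments.
Unset Strict Implicit.
Unset Printing Implicit Defensive.

Import GRing.Theory.
Local Open Scope ring_scope.

(* q \in N/d, to be used with 0 < d. *)
Definition nat_over (d : nat) (q : rat) : Prop :=
  exists k : nat, q = k%:R / d%:R.

Definition integer_square (q : rat) : Prop :=
  exists t : int, q = t%:~R ^+ 2.

(* Main.v *)
Require Import Defs.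
From Stdlib Require Import NArith.
From mathcomp Require Import all_boot all_order all_algebra.
From mathcomp Require Import all_solvable all_field realalg.
From mathcomp Require Import zify ring lra.

Set Implicit Arguments.
Unset Strict Implicit.
Unset Printing Implicit Defensive.

Import Order.TTheory GRing.Theory Num.Theory.
Local Open Scope ring_scope.

(** Put u = x + 2y + 2z, a = 2x + y - 2z and b = 2x - 2y + z. This linear map is
    three times an orthogonal one, so that
    9 (x^2 + y^2 + z^2) = u^2 + a^2 + b^2. Representing m with u = t^2 thus
    means writing 9m - t^4 as a^2 + b^2 + (3w)^2 with a, b in suitable classes
    modulo 9, and these congruences can always be met by permuting three squares
    and changing their signs ([signed_representation]). The residue of m modulo
    16 tells which parity of t makes 9m - t^4 a sum of three squares; if 16
    divides m, scaling by 4 reduces m to m / 16.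

    The integers x, y, z so obtained may be negative. The vectors
    (2, -2, 1, 2 s) and (2, 1, -2, 2 s), with s = 1 or -1, are orthogonal to
    (1, 2, 2, 0) and have norm 13; the reflections that they define preserve u,
    have denominator 13, and turn a negative b (or a) into a positive one. When
    t^4 >= 5m, one of them leads into the positive orthant, unless x, y, z are
    nonnegative from the start ([represented_of_signed]). Fourth powers of
    integers of a given parity are dense enough for 5m <= t^4 <= 9m to be
    solvable as soon as m >= 4269, and the smaller m are settled by
    enumeration.

    What remains is the three-square theorem [sum3sq]. For squarefree n it
    suffices to find d prime to n such that -n is a square modulo d and -d is a
    square modulo n: these two conditions produce a positive integral ternary
    form of determinant 1 that represents n, and reduction theory identifies
    every such form with a sum of three squares ([sum3sq_of_residues]). The
    existence of d is Gauss's existence theorem for genera. It is obtained here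
    without primes in arithmetic progressions: let chi be the quadratic
    character attached to -n and r(d) the sum of chi over the divisors of d, a
    nonnegative function which is at least 1 on squares. The sum of
    r(d) / sqrt d over the d <= K^2 prime to 8n is unbounded, whereas its twists
    by characters psi for which psi and psi chi are nontrivial stay bounded by
    the hyperbola method. Averaging over the twists that detect a class yields d in that class
    with r(d) <> 0, and the squarefree part of d has only prime factors p with
    chi p = 1 ([exists_squarefree_in_class]). Finally, chi p = 1 makes -n a
    square modulo p: a product of Gauss sums in characteristic p is a square
    root of -n which the Frobenius map multiplies by chi p
    ([sqrt_character_reciprocity]). *)

(** * Integral ternary forms of determinant one *)

Lemma balanced_remainder (a b : int) : 0 < a ->
  exists k : int, - a <= 2 * (b - k * a) <= a.
Proof.
move=> a_gt0; exists ((2 * b + a) %/ (2 * a))%Z.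
have := divz_eq (2 * b + a) (2 * a).
have := modz_ge0 (2 * b + a) (d := 2 * a) ltac:(lia).
have := ltz_pmod (2 * b + a) (d := 2 * a) ltac:(lia).
move: ((2 * b + a) %/ (2 * a))%Z ((2 * b + a) %% (2 * a))%Z => q r; lia.
Qed.

(** Gauss reduction of a x^2 + 2 b x y + c y^2: translating x brings 2|b| below
    a, and if then c < a, exchanging the variables decreases the leading
    coefficient. *)
Lemma binary_reduction (a b c : int) : 0 < a -> 0 < a * c - b ^+ 2 ->
  exists p q r s : int, p * s - q * r = 1 /\
    3 * (a * p ^+ 2 + 2 * b * p * r + c * r ^+ 2) ^+ 2
      <= 4 * (a * c - b ^+ 2).
Proof.
have [N] := ubnP `|a|%N; elim: N => // N IHN in a b c *.
move=> leaN a_gt0 D_gt0.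
have [k] := balanced_remainder b a_gt0.
set b' := b - k * a => b'_le.
pose c' := c - 2 * k * b + k ^+ 2 * a.
have eqD : a * c - b ^+ 2 = a * c' - b' ^+ 2 by rewrite /b' /c'; ring.
have b'2 : 4 * b' ^+ 2 <= a ^+ 2 by nia.
have [le_ac | lt_ca] := leP a c'.
  exists 1, 0, 0, 1; split=> //.
  rewrite eqD expr1n expr0n /= !mulr0 !addr0 mulr1; nia.
have c'_gt0 : 0 < c' by rewrite eqD in D_gt0; nia.
have [||p [q [r [s [det1 le4D]]]]] := IHN c' (- b') a _ c'_gt0.
- by move: leaN; lia.
- by rewrite (_ : c' * a - _ = a * c - b ^+ 2) // eqD; ring.
exists (r + k * p), (s + k * q), (- p), (- q); split.
  by rewrite -det1; ring.
rewrite (_ : a * c - b ^+ 2 = c' * a - (- b') ^+ 2); last by rewrite eqD; ring.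
apply: le_trans le4D; rewrite le_eqVlt; apply/orP; left; apply/eqP.
by rewrite /b' /c'; ring.
Qed.

Lemma unimodular_binary_sum2sq (a b c : int) : 0 < a -> a * c - b ^+ 2 = 1 ->
  forall x y : int, exists u v : int,
    a * x ^+ 2 + 2 * b * x * y + c * y ^+ 2 = u ^+ 2 + v ^+ 2.
Proof.
move=> a_gt0 D1 x y.
have [|p [q [r [s [det1 le4]]]]] := binary_reduction (b := b) (c := c) a_gt0; first lia.
set a' := a * p ^+ 2 + _ + _ in le4.
pose b' := a * p * q + b * (p * s + q * r) + c * r * s.
pose c' := a * q ^+ 2 + 2 * b * q * s + c * s ^+ 2.
have D'1 : a' * c' - b' ^+ 2 = 1.
  transitivity ((a * c - b ^+ 2) * (p * s - q * r) ^+ 2).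
    by rewrite /a' /b' /c'; ring.
  by rewrite D1 det1.
have a'1 : a' = 1.
  have a'_gt0 : 0 < a'.
    have a'_ge0 : 0 <= a'.
      rewrite -(pmulr_rge0 _ a_gt0) (_ : a * a' =
        (a * p + b * r) ^+ 2 + (a * c - b ^+ 2) * r ^+ 2); last first.
        by rewrite /a'; ring.
      by rewrite D1 mul1r addr_ge0 ?sqr_ge0.
    rewrite lt_def a'_ge0 andbT; apply/eqP => a'0.
    move: (sqr_ge0 b') D'1; rewrite a'0 mul0r; move: (b' ^+ 2) => B; clear; lia.
  rewrite D1 in le4; move: a'_gt0 le4; move: a' {D'1 b' c'} => a'; clear; nia.
pose X := s * x - q * y; pose Y := p * y - r * x.
have -> : a * x ^+ 2 + 2 * b * x * y + c * y ^+ 2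
        = a' * X ^+ 2 + 2 * b' * X * Y + c' * Y ^+ 2.
  have ex : x = p * X + q * Y.
    by rewrite -[LHS]mul1r -det1 /X /Y; ring.
  have ey : y = r * X + s * Y.
    by rewrite -[LHS]mul1r -det1 /X /Y; ring.
  by rewrite {1 2}ex {1 2}ey /a' /b' /c'; ring.
exists (X + b' * Y), Y.
have c'E : c' = 1 + b' ^+ 2 by rewrite -{1}D'1 a'1; ring.
by rewrite a'1 c'E; ring.
Qed.

(** Hermite reduction. With g the binary form of determinant a that is left after
    completing the square in x, reducing g and then translating x makes the new
    coefficient d2 of y^2 satisfy a * d2 <= g11 + a^2 / 4 with 3 g11^2 <= 4 a.
    Unless a = 1 this forces d2 < a, and exchanging x with y decreases a. Only
    values of the form are followed through the changes of variables, so the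
    matrices need not be composed. *)
Lemma unimodular_ternary_sum3sq (a b c d e f : int) :
  0 < a -> 0 < a * d - b ^+ 2 ->
  a * (d * f - e ^+ 2) - b * (b * f - e * c) + c * (b * e - d * c) = 1 ->
  forall x y z : int, exists u v w : int,
    a * x ^+ 2 + 2 * b * x * y + 2 * c * x * z
      + d * y ^+ 2 + 2 * e * y * z + f * z ^+ 2
    = u ^+ 2 + v ^+ 2 + w ^+ 2.
Proof.
have [N] := ubnP `|a|%N; elim: N => // N IHN in a b c d e f *.
move=> leaN a_gt0 D2_gt0 det1 x y z.
pose g12 := a * e - b * c; pose g22 := a * f - c ^+ 2.
have detg : (a * d - b ^+ 2) * g22 - g12 ^+ 2 = a.
  by rewrite -[RHS]mulr1 -det1 /g12 /g22; ring.
have [a1 | a_neq1] := eqVneq a 1.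
  have [|u [v uv]] := @unimodular_binary_sum2sq _ g12 g22 D2_gt0 _ y z.
    by rewrite detg.
  exists (x + b * y + c * z), u, v.
  by rewrite -[RHS]addrA -uv /g12 /g22 a1; ring.
have [|p [q [r [s [ps1 le4]]]]] := binary_reduction (b := g12) (c := g22) D2_gt0.
  by rewrite detg.
rewrite detg in le4.
pose b1 := b * p + c * r; pose c1 := b * q + c * s.
pose d1 := d * p ^+ 2 + 2 * e * p * r + f * r ^+ 2.
pose e1 := d * p * q + e * (p * s + q * r) + f * r * s.
pose f1 := d * q ^+ 2 + 2 * e * q * s + f * s ^+ 2.
have [k b2_le] := balanced_remainder b1 a_gt0.
pose b2 := b1 - k * a; rewrite -/b2 in b2_le.
pose d2 := d1 - 2 * k * b1 + k ^+ 2 * a; pose e2 := e1 - k * c1.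
have gE : a * d2 - b2 ^+ 2 = (a * d - b ^+ 2) * p ^+ 2 + 2 * g12 * p * r
                             + g22 * r ^+ 2.
  by rewrite /d2 /b2 /d1 /b1 /g12 /g22; ring.
rewrite -gE in le4.
have g_gt0 : 0 < a * d2 - b2 ^+ 2.
  have : (a * d - b ^+ 2) * (a * d2 - b2 ^+ 2) =
     ((a * d - b ^+ 2) * p + g12 * r) ^+ 2 + a * r ^+ 2.
    rewrite gE; transitivity (((a * d - b ^+ 2) * p + g12 * r) ^+ 2
      + ((a * d - b ^+ 2) * g22 - g12 ^+ 2) * r ^+ 2); last by rewrite detg.
    by ring.
  move=> AG; rewrite -(pmulr_rgt0 _ D2_gt0) AG.
  have [r0 | r_neq0] := eqVneq r 0; last first.
    by rewrite ltr_wpDl ?sqr_ge0 // mulr_gt0 // exprn_even_gt0.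
  have p_neq0 : p != 0 by apply/eqP => p0; move: ps1; rewrite p0 r0; lia.
  rewrite r0 expr0n /= !mulr0 !addr0.
  by rewrite exprn_even_gt0 //= mulf_neq0 // gt_eqF.
have lt_d2a : d2 < a.
  rewrite ltNge; apply/negP => le_ad2.
  have {le_ad2} le34 : 3 * a ^+ 2 <= 4 * (a * d2 - b2 ^+ 2).
    move: b2_le le_ad2; clear -a_gt0; clearbody b2 d2; nia.
  move: (a * d2 - b2 ^+ 2) g_gt0 le4 le34; clear -a_gt0 a_neq1.
  move=> G G_gt0 le4 le34.
  have : 9 * a ^+ 4 <= 16 * G ^+ 2.
    rewrite (_ : 9 * _ = (3 * a ^+ 2) ^+ 2); last ring.
    rewrite (_ : 16 * _ = (4 * G) ^+ 2); last ring.
    by rewrite ler_sqr ?nnegrE //; nia.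
  have : 8 * a <= a ^+ 4.
    rewrite [a ^+ 4]exprSr ler_wpM2r ?(ltW a_gt0) // (_ : 8 = 2 ^+ 3) //.
    by rewrite lerXn2r ?nnegrE //; lia.
  lia.
have d2_gt0 : 0 < d2.
  rewrite -(pmulr_rgt0 _ a_gt0) -(subrK (b2 ^+ 2) (a * d2)).
  by rewrite ltr_wpDr ?sqr_ge0.
have [|||u [v [w uvw]]] := IHN d2 b2 e2 a c1 f1 _ d2_gt0 _ _
    (s * y - q * z) (x + k * (s * y - q * z)) (p * z - r * y).
- by move: leaN lt_d2a d2_gt0; clear; clearbody d2; lia.
- by rewrite mulrC.
- rewrite -det1 -[RHS]mulr1 -(expr1n _ 2) -{}ps1.
  by rewrite /d2 /b2 /e2 /c1 /f1 /d1 /b1 /e1; ring.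
exists u, v, w; rewrite -uvw.
pose Y := s * y - q * z; pose Z := p * z - r * y.
have ey : y = p * Y + q * Z by rewrite -[LHS]mul1r -ps1 /Y /Z; ring.
have ez : z = r * Y + s * Z by rewrite -[LHS]mul1r -ps1 /Y /Z; ring.
rewrite -/Y -/Z {1 2 3}ey {1 2 3}ez.
by rewrite /d2 /b2 /e2 /c1 /f1 /d1 /b1 /e1; ring.
Qed.

(** The form with Gram matrix (a t s; t d 0; s 0 n), where a d = t^2 + b, has
    determinant n b - s^2 d = 1, and it takes the value n at (0, 0, 1). *)
Lemma sum3sq_of_residues (n d s t b : int) : 0 < n -> 0 < d ->
  b * n = 1 + s ^+ 2 * d -> (d %| t ^+ 2 + b)%Z ->
  exists u v w : int, n = u ^+ 2 + v ^+ 2 + w ^+ 2.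
Proof.
move=> n_gt0 d_gt0 bn /dvdzP[a ad].
have b_gt0 : 0 < b.
  have : 0 < b * n.
    by rewrite bn ltr_pwDl // mulr_ge0 ?sqr_ge0 // ltW.
  by rewrite pmulr_lgt0.
have [||| u [v [w uvw]]] := @unimodular_ternary_sum3sq a t s d 0 n _ _ _ 0 0 1.
- have : 0 < a * d by rewrite -ad ltr_wpDl ?sqr_ge0.
  by rewrite pmulr_lgt0.
- by rewrite -ad; lia.
- transitivity (n * (a * d - t ^+ 2) - s ^+ 2 * d); first by ring.
  by rewrite -ad; transitivity (b * n - s ^+ 2 * d); [ring | rewrite bn; ring].
by exists u, v, w; rewrite -uvw; ring.
Qed.

(** * The hyperbola method with weights 1/sqrt a *)

Section Hyperbola.
Variable R : rcfType.
Implicit Types (w g : nat -> R) (C : R).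

(** Summation by parts; the induction carries the boundary term G(n) w(n), where
    G is the summatory function of g. *)
Lemma abel_bound w g C m n : (m <= n)%N ->
    (forall k, (m <= k)%N -> 0 <= w k.+1 <= w k) ->
    (forall k, `|\sum_(m <= a < k) g a| <= C) ->
  `|\sum_(m <= a < n) g a * w a| <= C * w m.
Proof.
move=> le_mn w_le bound.
suff le_diff : `|\sum_(m <= a < n) g a * w a - (\sum_(m <= a < n) g a) * w n|
               <= C * (w m - w n).
  rewrite -(subrK ((\sum_(m <= a < n) g a) * w n) (\sum_(_ <= _ < _) _ * _)).
  rewrite (le_trans (ler_normD _ _)) //.
  have wn_ge0 : 0 <= w n by have /andP[] := w_le n le_mn; apply: le_trans.
  rewrite normrM (ger0_norm wn_ge0).
  apply: le_trans (lerD le_diff (ler_wpM2r wn_ge0 (bound n))) _.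
  by rewrite -mulrDr subrK.
elim: n le_mn => [|n IHn].
  rewrite leqn0 => /eqP->; rewrite !big_geq // mul0r !subrr normr0 mulr0 //.
rewrite leq_eqVlt => /predU1P[<- | ].
  by rewrite !big_geq // mul0r !subrr normr0 mulr0.
rewrite ltnS => le_mn; have /andP[w_ge0 w_dec] := w_le n le_mn.
rewrite big_nat_recr //=.
set A := \sum_(m <= a < n) g a * w a in IHn *.
have GS : \sum_(m <= a < n.+1) g a = \sum_(m <= a < n) g a + g n.
  by rewrite big_nat_recr.
rewrite (_ : A + _ - _ = (A - (\sum_(m <= a < n) g a) * w n)
    + (\sum_(m <= a < n.+1) g a) * (w n - w n.+1)); last by rewrite GS; ring.
rewrite (le_trans (ler_normD _ _)) // normrM (ger0_norm (_ : 0 <= w n - w n.+1)).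
  rewrite (_ : w m - w n.+1 = (w m - w n) + (w n - w n.+1)); last ring.
  rewrite [leRHS]mulrDr; apply: lerD; first exact: IHn.
  by rewrite ler_wpM2r // subr_ge0.
by rewrite subr_ge0.
Qed.

Definition invsqrt (a : nat) : R := (Num.sqrt a%:R)^-1.

Lemma invsqrt_ge0 a : 0 <= invsqrt a.
Proof. by rewrite invr_ge0 sqrtr_ge0. Qed.

Lemma invsqrtM a b : invsqrt (a * b) = invsqrt a * invsqrt b.
Proof. by rewrite /invsqrt natrM sqrtrM ?ler0n // invfM. Qed.

Lemma invsqrt_sqr a : invsqrt (a ^ 2) = a%:R^-1.
Proof. by rewrite /invsqrt natrX sqrtr_sqr ger0_norm ?ler0n. Qed.

Lemma invsqrt_le a b : (0 < a <= b)%N -> invsqrt b <= invsqrt a.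
Proof.
case/andP=> a_gt0 le_ab; rewrite lef_pV2 ?posrE ?sqrtr_gt0 ?ltr0n //.
  by rewrite ler_wsqrtr // ler_nat.
exact: leq_trans le_ab.
Qed.

Lemma sum_invsqrt_le K :
  \sum_(1 <= a < K.+1) invsqrt a <= 2 * Num.sqrt K%:R.
Proof.
elim: K => [|K IHK]; first by rewrite big_geq // mulr_ge0 ?sqrtr_ge0.
rewrite big_nat_recr //= (le_trans (lerD IHK (lexx _))) //.
rewrite /invsqrt; set x := Num.sqrt K%:R; set y := Num.sqrt _.
have y_gt0 : 0 < y by rewrite sqrtr_gt0 ltr0n.
have x2 : x ^+ 2 = K%:R by rewrite sqr_sqrtr ?ler0n.
have y2 : y ^+ 2 = K%:R + 1 by rewrite sqr_sqrtr ?ler0n // -natr1.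
have x_ge0 : 0 <= x := sqrtr_ge0 _.
rewrite -(ler_pM2r y_gt0) mulrDl mulVf ?gt_eqF //; nra.
Qed.

Variables (al be : nat -> R) (C : R).
Hypotheses (al_bound : forall m n, `|\sum_(m <= a < n) al a| <= C)
  (be_bound : forall m n, `|\sum_(m <= a < n) be a| <= C)
  (al_le1 : forall a, `|al a| <= 1) (be_le1 : forall a, `|be a| <= 1).

Let inner_bound g K n : (forall m n, `|\sum_(m <= a < n) g a| <= C) ->
  `|\sum_(K.+1 <= b < n) g b * invsqrt b| <= C * invsqrt K.+1.
Proof.
move=> bound; have C_ge0 : 0 <= C := le_trans (normr_ge0 _) (bound 0%N 0%N).
have [le_Kn | lt_nK] := leqP K.+1 n; last first.
  by rewrite big_geq ?normr0 ?mulr_ge0 ?invsqrt_ge0 // ltnW.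
apply: abel_bound => // k le_Kk.
by rewrite invsqrt_ge0 invsqrt_le // leqnSn (leq_trans _ le_Kk).
Qed.

Let cross_bound f g K (h : nat -> nat) : (forall a, `|f a| <= 1) ->
    (forall m n, `|\sum_(m <= a < n) g a| <= C) ->
  `|\sum_(1 <= a < K.+1) f a * invsqrt a
      * \sum_(K.+1 <= b < h a) g b * invsqrt b| <= 2 * C.
Proof.
move=> f_le1 bound; have C_ge0 : 0 <= C := le_trans (normr_ge0 _) (bound 0%N 0%N).
apply: le_trans (ler_norm_sum _ _ _) _.
apply: (@le_trans _ _ (\sum_(1 <= a < K.+1) invsqrt a * (C * invsqrt K.+1))).
  apply: ler_sum => a _; rewrite !normrM (ger0_norm (invsqrt_ge0 a)).
  by rewrite ler_pM ?mulr_ge0 ?normr_ge0 ?invsqrt_ge0 ?inner_bound //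
    ler_piMl ?invsqrt_ge0.
rewrite -mulr_suml.
apply: (@le_trans _ _ (2 * Num.sqrt K%:R * (C * invsqrt K.+1))).
  by rewrite ler_wpM2r ?mulr_ge0 ?invsqrt_ge0 ?sum_invsqrt_le.
rewrite -mulrA ler_wpM2l // mulrCA ler_piMr //.
rewrite /invsqrt -ler_pdivlMr ?invr_gt0 ?sqrtr_gt0 ?ltr0n // invrK mul1r.
by rewrite ler_wsqrtr // ler_nat.
Qed.

(** The region a b <= K^2 is the square a, b <= K together with two tails,
    a <= K < b and b <= K < a. On the square the sum factors into two bounded
    sums; on a tail each inner sum is at most C / sqrt K by [abel_bound], while
    the outer weights add up to at most 2 sqrt K. This balance is what makes
    1 / sqrt the right weight: the sum of the same weight over squares is
    harmonic, hence still divergent. *)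
Lemma hyperbola_bound K :
  `|\sum_(1 <= a < (K ^ 2).+1) \sum_(1 <= b < (K ^ 2).+1 | (a * b <= K ^ 2)%N)
      al a * be b * invsqrt (a * b)| <= C ^+ 2 + 4 * C.
Proof.
have C_ge0 : 0 <= C := le_trans (normr_ge0 _) (al_bound 0%N 0%N).
set X := (K ^ 2)%N; pose u a b := al a * be b * invsqrt (a * b).
have le_KX : (K.+1 <= X.+1)%N.
  by rewrite ltnS /X -mulnn; case: (K) => // k; exact: leq_pmull.
have -> : \sum_(1 <= a < X.+1) \sum_(1 <= b < X.+1 | (a * b <= X)%N) u a b
  = (\sum_(1 <= a < K.+1) al a * invsqrt a)
      * (\sum_(1 <= b < K.+1) be b * invsqrt b)
  + \sum_(1 <= a < K.+1) al a * invsqrt a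
      * (\sum_(K.+1 <= b < (X %/ a).+1) be b * invsqrt b)
  + \sum_(1 <= b < K.+1) be b * invsqrt b
      * (\sum_(K.+1 <= a < (X %/ b).+1) al a * invsqrt a).
  have inner (F : nat -> R) a : (0 < a)%N ->
      \sum_(K.+1 <= b < X.+1 | (a * b <= X)%N) F b
      = \sum_(K.+1 <= b < (X %/ a).+1) F b.
    move=> a_gt0; rewrite [RHS](@big_nat_widen _ _ _ _ _ X.+1).
      by apply: eq_bigl => b; rewrite ltnS leq_divRL // mulnC.
    by rewrite ltnS leq_div.
  rewrite (big_cat_nat (n := K.+1)) //=; congr (_ + _).
    rewrite big_distrl /= -big_split /=; apply: eq_big_nat => a /andP[a_gt0 a_lt].
    rewrite (big_cat_nat (n := K.+1)) //= inner // -mulrDr.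
    have -> : \sum_(1 <= b < K.+1 | (a * b <= X)%N) u a b
            = \sum_(1 <= b < K.+1) u a b.
      rewrite big_nat_cond [RHS]big_nat_cond; apply: eq_bigl => b.
      apply: andb_id2l => /andP[_ b_lt]; rewrite /X -mulnn leq_mul //.
    rewrite mulrDr !big_distrr /=; congr (_ + _);
      apply: eq_bigr => b _; rewrite /u invsqrtM; ring.
  transitivity (\sum_(K.+1 <= a < X.+1)
                  \sum_(1 <= b < K.+1 | (a * b <= X)%N) u a b).
    apply: eq_big_nat => a /andP[a_gt a_lt].
    rewrite (big_cat_nat (n := K.+1)) //= [X in _ + X]big_nat_cond.
    rewrite [X in _ + X]big1 ?addr0 // => b /andP[/andP[b_gt _]].
    rewrite /X => abX; have := leq_mul a_gt b_gt; lia.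
  rewrite (exchange_big_dep_nat xpredT) //=.
  apply: eq_big_nat => b /andP[b_gt0 b_lt].
  rewrite (eq_bigl (fun a => (b * a <= X)%N)); last by move=> a; rewrite mulnC.
  rewrite inner // big_distrr /=.
  by apply: eq_bigr => a _; rewrite /u invsqrtM; ring.
rewrite (le_trans (ler_normD _ _)) //.
rewrite (_ : C ^+ 2 + 4 * C = (C ^+ 2 + 2 * C) + 2 * C); last ring.
apply: lerD; last exact: cross_bound.
rewrite (le_trans (ler_normD _ _)) // lerD ?cross_bound //.
have w1 : invsqrt 1 = 1 by rewrite /invsqrt sqrtr1 invr1.
rewrite normrM expr2 ler_pM //.
  by rewrite -[leRHS]mulr1 -w1; apply: inner_bound.
by rewrite -[leRHS]mulr1 -w1; apply: inner_bound.
Qed.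

End Hyperbola.

(** * Real characters and their divisor sums *)

(** Multiplicative characters modulo N of order at most two, as functions on the
    natural numbers. The last condition says at once that values at integers
    prime to N are 1 or -1 and that all other values vanish. *)
Record realchar (N : nat) (f : nat -> int) : Prop := RealChar {
  realchar1 : f 1%N = 1;
  realcharM : forall a b, f (a * b)%N = f a * f b;
  realchar_mod : forall a, f (a %% N)%N = f a;
  realchar_sqr : forall a, f a ^+ 2 = (coprime a N)%:R }.

Definition trivchar (N a : nat) : int := (coprime a N)%:R.

Lemma trivchar_real N : realchar N (trivchar N).
Proof.
split=> [|a b|a|a]; rewrite /trivchar ?coprime1n //.
- by rewrite coprimeMl; do 2 case: coprime.
- by rewrite coprime_modl.
- by case: coprime.
Qed.

Lemma realchar_mul M N f g : realchar M f -> realchar N g ->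
  realchar (M * N) (fun a => f a * g a).
Proof.
move=> rf rg; split=> [|a b|a|a].
- by rewrite (realchar1 rf) (realchar1 rg).
- by rewrite (realcharM rf) (realcharM rg) mulrACA.
- rewrite -(realchar_mod rf) -(realchar_mod rg).
  by rewrite (modn_dvdm a (dvdn_mulr N (dvdnn M))) (modn_dvdm a (dvdn_mull M (dvdnn N)))
     (realchar_mod rf) (realchar_mod rg).
- rewrite exprMn (realchar_sqr rf) (realchar_sqr rg) coprimeMr.
  by do 2 case: coprime.
Qed.

Lemma realchar_le1 N f a : realchar N f -> `|f a| <= 1.
Proof.
move=> rf; have := realchar_sqr rf a.
case: coprime => /eqP; first by rewrite sqrf_eq1 => /orP[] /eqP->.
by rewrite sqrf_eq0 => /eqP->.
Qed.

Lemma realchar_coprime N f a : realchar N f -> coprime a N ->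
  f a = 1 \/ f a = -1.
Proof.
move=> rf co_aN; have /eqP := realchar_sqr rf a.
by rewrite co_aN sqrf_eq1 => /orP[] /eqP; [left | right].
Qed.

Lemma realchar0 N f a : realchar N f -> ~~ coprime a N -> f a = 0.
Proof.
by move=> rf /negbTE co_aN; have /eqP := realchar_sqr rf a;
  rewrite co_aN sqrf_eq0 => /eqP.
Qed.

Lemma realchar_neq0_coprime N f a : realchar N f -> f a != 0 -> coprime a N.
Proof. by move=> rf; apply: contraNT => /(realchar0 rf)->. Qed.

Lemma realcharX N f a k : realchar N f -> f (a ^ k)%N = f a ^+ k.
Proof.
move=> rf; elim: k => [|k IHk]; first by rewrite (realchar1 rf).
by rewrite expnS exprS (realcharM rf) IHk.
Qed.

(** For a character with values 0, 1 and -1 this is nontriviality. *)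
Definition nonprincipal (f : nat -> int) := exists u, f u = -1.

(** By the Chinese remainder theorem there is an integer at which f takes the
    value -1 and which is 1 modulo N. *)
Lemma nonprincipal_mull M N f g : (0 < M)%N -> (0 < N)%N -> coprime M N ->
  realchar M f -> realchar N g ->
  nonprincipal f -> nonprincipal (fun a => f a * g a).
Proof.
move=> M_gt0 N_gt0 coMN rf rg [u fu]; exists (chinese M N u 1).
rewrite -(realchar_mod rf) -(realchar_mod rg).
by rewrite chinese_modl // chinese_modr // !realchar_mod // fu (realchar1 rg) mulr1.
Qed.

Lemma nonprincipal_mulr M N f g : (0 < M)%N -> (0 < N)%N -> coprime M N ->
  realchar M f -> realchar N g ->
  nonprincipal g -> nonprincipal (fun a => f a * g a).
Proof.
move=> M_gt0 N_gt0 coMN rf rg [u gu]; exists (chinese M N 1 u).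
rewrite -(realchar_mod rf) -(realchar_mod rg).
by rewrite chinese_modl // chinese_modr // !realchar_mod // gu (realchar1 rf) mul1r.
Qed.

(** Multiplication by u permutes the residues and changes the sign of the sum. *)
Lemma realchar_sum0 N f : (0 < N)%N -> realchar N f -> nonprincipal f ->
  \sum_(0 <= a < N) f a = 0.
Proof.
move=> N_gt0 rf [u fu].
have co_uN : coprime u N by apply: (realchar_neq0_coprime rf); rewrite fu.
pose h (a : 'I_N) : 'I_N := Ordinal (ltn_pmod (u * a) N_gt0).
have h_inj : injective h.
  move=> a b /(congr1 val) /= /eqP eq_ab; apply/val_inj => /=.
  wlog le_ba : a b eq_ab / (b <= a)%N.
    move=> W; have [] := leqP b a; first exact: W.
    by move=> /ltnW /W -> //; rewrite eq_sym.
  move: eq_ab; rewrite eqn_mod_dvd ?leq_mul // -mulnBr Gauss_dvdr; last first.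
    by rewrite coprime_sym.
  case: (posnP (a - b)) => [|ab_gt0 /(dvdn_leq ab_gt0)]; first lia.
  by have := ltn_ord a; lia.
have : \sum_(a < N) f a = - \sum_(a < N) f a.
  rewrite {1}(reindex_inj h_inj) /= -sumrN; apply: eq_bigr => a _.
  by rewrite (realchar_mod rf) (realcharM rf) fu mulN1r.
by rewrite big_mkord; move: (\sum_(_ < _) _) => S; lia.
Qed.

Lemma realchar_sum_le N f m n : (0 < N)%N -> realchar N f -> nonprincipal f ->
  `|\sum_(m <= a < n) f a| <= (N + N)%:R.
Proof.
move=> N_gt0 rf npf.
suff init k : `|\sum_(0 <= a < k) f a| <= N%:R.
  have [le_nm | /ltnW le_mn] := leqP n m; first by rewrite big_geq ?normr0.
  have := init n; have := init m; rewrite (big_cat_nat (leq0n m) le_mn) /=.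
  by move: (\sum_(0 <= _ < m) _) (\sum_(m <= _ < n) _) => S1 S2; lia.
have [n0] := ubnP k; elim: n0 => // n0 IH in k *; move=> lt_k.
have [le_kN | lt_Nk] := leqP k N.
  apply: le_trans (ler_norm_sum _ _ _) _.
  apply: (@le_trans _ _ (\sum_(0 <= a < k) 1)).
    by apply: ler_sum => a _; apply: realchar_le1 rf.
  by rewrite sumr_const_nat subn0 ler_nat.
rewrite (big_cat_nat (leq0n N) (ltnW lt_Nk)) /= realchar_sum0 // add0r.
rewrite -{1}(add0n N) big_addn.
under eq_bigr => a _ do rewrite -(realchar_mod rf) modnDr (realchar_mod rf).
by apply: IH; lia.
Qed.

(** The Dirichlet convolution of 1 and chi; for chi attached to a quadratic
    field it counts the ideals of norm n. *)
Definition charsum (chi : nat -> int) (n : nat) : int :=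
  \sum_(d <- divisors n) chi d.

Lemma divisors_pfactor_mul p k m : prime p -> ~~ (p %| m)%N -> (0 < m)%N ->
  perm_eq (divisors (p ^ k * m))
          [seq (p ^ j * e)%N | j <- iota 0 k.+1, e <- divisors m].
Proof.
move=> p_pr pm m_gt0; have p_gt0 := prime_gt0 p_pr.
have e_co e : e \in divisors m -> ~~ (p %| e)%N.
  rewrite -dvdn_divisors // => em; apply: contra pm => pe.
  exact: dvdn_trans em.
apply: uniq_perm; first exact: divisors_uniq.
  apply: allpairs_uniq; [exact: iota_uniq | exact: divisors_uniq |].
  move=> x y /allpairsP[[i1 e1] [_ he1 ->]].
  move=> /allpairsP[[i2 e2] [_ he2 ->]]; rewrite /= in he1 he2 * => eq_pe.
  have lg i e0 : e0 \in divisors m -> logn p (p ^ i * e0) = i.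
    move=> e0m; have e0_gt0 : (0 < e0)%N 
      by apply: (dvdn_gt0 m_gt0); rewrite dvdn_divisors.
    rewrite lognM ?expn_gt0 ?p_gt0 // pfactorK // logn_coprime ?addn0 //.
    by rewrite prime_coprime // e_co.
  have eq_i : i1 = i2 by rewrite -(lg i1 e1) // eq_pe lg.
  by move/eqP: eq_pe; rewrite eq_i eqn_pmul2l ?expn_gt0 ?p_gt0 // => /eqP->.
move=> d; rewrite -dvdn_divisors ?muln_gt0 ?expn_gt0 ?p_gt0 //.
apply/idP/allpairsP => [d_dvd | [[j e] [j_le em ->]]]; last first.
  move: j_le; rewrite mem_iota add0n ltnS /= in em * => j_le.
  by rewrite dvdn_mul ?dvdn_exp2l // dvdn_divisors.
have d_gt0 : (0 < d)%N.
  by apply: dvdn_gt0 d_dvd; rewrite muln_gt0 expn_gt0 p_gt0.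
have [e co_pe dE] := pfactor_coprime p_pr d_gt0.
exists (logn p d, e); split; last by rewrite mulnC.
  rewrite mem_iota add0n ltnS /= -[leqRHS](pfactorK k p_pr).
  rewrite -[X in (_ <= X)%N]addn0 -(_ : logn p m = 0%N); last first.
    by rewrite logn_coprime ?prime_coprime.
  by rewrite -lognM ?expn_gt0 ?p_gt0 // dvdn_leq_log ?muln_gt0 ?expn_gt0 ?p_gt0.
rewrite /= -dvdn_divisors // -(Gauss_dvdr _ (_ : coprime e (p ^ k))).
  by apply: dvdn_trans d_dvd; rewrite dE dvdn_mulr.
by rewrite coprimeXr // coprime_sym.
Qed.

Lemma charsum_pfactor_mul N chi p k m : realchar N chi ->
    prime p -> ~~ (p %| m)%N -> (0 < m)%N ->
  charsum chi (p ^ k * m) = (\sum_(0 <= j < k.+1) chi p ^+ j) * charsum chi m.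
Proof.
move=> rchi p_pr pm m_gt0.
rewrite /charsum (perm_big _ (divisors_pfactor_mul k p_pr pm m_gt0)).
rewrite big_allpairs_dep -[iota 0 k.+1]/(index_iota 0 k.+1) mulr_suml.
apply: eq_bigr => j _; rewrite mulr_sumr; apply: eq_bigr => e _.
by rewrite (realcharM rchi) (realcharX _ _ rchi).
Qed.

Lemma alternating_sum k :
  \sum_(0 <= j < k.+1) (-1) ^+ j = (if odd k then 0 else 1) :> int.
Proof.
elim: k => [|k IHk]; first by rewrite big_nat1.
by rewrite big_nat_recr //= IHk -signr_odd /=; case: (odd k).
Qed.

Lemma geom_sum_sign (x : int) k : x ^+ 2 <= 1 ->
  (if odd k then 0 else 1) <= \sum_(0 <= j < k.+1) x ^+ j.
Proof.
move=> x2; have : (x == 0) || (x == 1) || (x == -1) by nia.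
case/orP => [/orP[]|] /eqP->.
- rewrite big_nat_recl // expr0 big1 ?addr0; first by case: odd.
  by move=> j _; rewrite exprS mul0r.
- under eq_bigr => j _ do rewrite expr1n.
  rewrite sumr_const_nat subn0; case: odd => //; lia.
by rewrite alternating_sum.
Qed.

Lemma partn_pfactor n p : prime p -> (0 < n)%N ->
  exists2 m, n = (p ^ logn p n * m)%N & ~~ (p %| m)%N /\ (0 < m)%N.
Proof.
move=> p_pr n_gt0; have [m co_pm nE] := pfactor_coprime p_pr n_gt0.
exists m; first by rewrite mulnC.
rewrite -prime_coprime //; split=> //.
by move: n_gt0; rewrite nE muln_gt0 => /andP[].
Qed.

Lemma realchar_sqr_le1 N f a : realchar N f -> f a ^+ 2 <= 1.
Proof. by move=> rf; rewrite (realchar_sqr rf); case: coprime. Qed.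

Lemma charsum_ge0 N chi n : realchar N chi -> (0 < n)%N -> 0 <= charsum chi n.
Proof.
move=> rchi; have [n0] := ubnP n; elim: n0 => // n0 IH in n *; move=> lt_n n_gt0.
have [n1 | n_gt1] := leqP n 1.
  have -> : n = 1%N by lia.
  by rewrite /charsum big_seq1 (realchar1 rchi).
have p_pr := pdiv_prime n_gt1.
have [m nE [pm m_gt0]] := partn_pfactor p_pr n_gt0.
rewrite nE (charsum_pfactor_mul _ rchi) // mulr_ge0 //.
  apply: le_trans (geom_sum_sign _ (realchar_sqr_le1 _ rchi)).
  by case: odd.
apply: IH => //; apply: (@leq_trans n) => //.
rewrite [ltnRHS]nE -{1}(mul1n m) ltn_pmul2r // -(expn0 (pdiv n)).
by rewrite ltn_exp2l ?prime_gt1 // logn_gt0 mem_primes p_pr n_gt0 pdiv_dvd.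
Qed.

Lemma charsum_square_ge1 N chi n : realchar N chi -> (0 < n)%N ->
  1 <= charsum chi (n ^ 2).
Proof.
move=> rchi; have [n0] := ubnP n; elim: n0 => // n0 IH in n *; move=> lt_n n_gt0.
have [n1 | n_gt1] := leqP n 1.
  have -> : n = 1%N by lia.
  by rewrite /charsum big_seq1 (realchar1 rchi).
have p_pr := pdiv_prime n_gt1.
have [m nE [pm m_gt0]] := partn_pfactor p_pr n_gt0.
rewrite nE expnMn -expnM (charsum_pfactor_mul _ rchi) ?expn_gt0 ?m_gt0 //;
  last by rewrite Euclid_dvdX // andbT.
rewrite -[1]mulr1 ler_pM //.
  apply: le_trans (geom_sum_sign _ (realchar_sqr_le1 _ rchi)).
  by rewrite oddM andbF.
apply: IH => //; apply: (@leq_trans n) => //.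
rewrite [ltnRHS]nE -{1}(mul1n m) ltn_pmul2r // -(expn0 (pdiv n)).
by rewrite ltn_exp2l ?prime_gt1 // logn_gt0 mem_primes p_pr n_gt0 pdiv_dvd.
Qed.

(** If chi p = -1, the local factor 1 + chi p + ... + (chi p)^k vanishes for odd
    k. *)
Lemma charsum_neq0_odd N chi n p : realchar N chi -> prime p -> (0 < n)%N ->
  charsum chi n != 0 -> odd (logn p n) -> chi p <> -1.
Proof.
move=> rchi p_pr n_gt0; have [m nE [pm m_gt0]] := partn_pfactor p_pr n_gt0.
rewrite {1}nE (charsum_pfactor_mul _ rchi) // mulf_eq0 negb_or => /andP[sum_neq0 _].
by move=> odd_k chi_p; case/eqP: sum_neq0; rewrite chi_p alternating_sum odd_k.
Qed.

(** * Summation over products, divergence, squarefree parts *)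

Lemma sum_by_product (V : nmodType) X (F : nat -> nat -> V) :
  \sum_(1 <= a < X.+1) \sum_(1 <= b < X.+1 | (a * b <= X)%N) F a b
  = \sum_(1 <= d < X.+1) \sum_(b <- divisors d) F (d %/ b)%N b.
Proof.
transitivity (\sum_(1 <= d < X.+1) \sum_(1 <= b < X.+1 | (b %| d)%N)
                F (d %/ b)%N b); last first.
  apply: eq_big_nat => d /andP[d_gt0 d_le].
  rewrite -big_filter; apply: perm_big; apply: uniq_perm.
  - by rewrite filter_uniq ?iota_uniq.
  - exact: divisors_uniq.
  move=> b; rewrite mem_filter mem_index_iota -dvdn_divisors //.
  case b_d: (b %| d)%N => //=.
  by have := dvdn_leq d_gt0 b_d; have := dvdn_gt0 d_gt0 b_d; lia.
rewrite (exchange_big_dep_nat xpredT) //= [RHS](exchange_big_dep_nat xpredT) //=.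
apply: eq_big_nat => b /andP[b_gt0 b_le].
rewrite -big_filter -[RHS]big_filter.
transitivity (\sum_(d <- [seq (a * b)%N |
    a <- [seq a <- index_iota 1 X.+1 | (a * b <= X)%N]]) F (d %/ b)%N b).
  by rewrite big_map; apply: eq_bigr => a _; rewrite mulnK.
apply: perm_big; apply: uniq_perm.
- rewrite map_inj_uniq ?filter_uniq ?iota_uniq // => a a' /eqP.
  by rewrite eqn_pmul2r // => /eqP.
- by rewrite filter_uniq ?iota_uniq.
move=> d; rewrite mem_filter mem_index_iota; apply/mapP/idP.
  move=> [a]; rewrite mem_filter mem_index_iota => /and3P[ab_le a_gt0 _] ->.
  by rewrite dvdn_mull //= muln_gt0 a_gt0 b_gt0.
case/and3P=> /dvdnP[a ->]; rewrite muln_gt0 => /andP[a_gt0 _] ab_lt.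
exists a => //; rewrite mem_filter mem_index_iota a_gt0.
by have := leq_pmulr a b_gt0; lia.
Qed.

Lemma sum_squares_le (R : numDomainType) (F : nat -> R) K :
    (forall d, (0 < d)%N -> 0 <= F d) ->
  \sum_(1 <= k < K.+1) F (k ^ 2)%N <= \sum_(1 <= d < (K ^ 2).+1) F d.
Proof.
move=> F_ge0; elim: K => [|K IHK]; first by rewrite !big_geq.
rewrite big_nat_recr //= [leRHS]big_nat_recr ?expn_gt0 //= lerD2r.
apply: le_trans IHK _.
rewrite [leRHS](big_cat_nat (n := (K ^ 2).+1)) //=; last first.
  by rewrite ltn_exp2r.
rewrite lerDl big_nat_cond sumr_ge0 // => d /andP[/andP[d_gt _] _].
exact: F_ge0 (leq_ltn_trans _ d_gt).
Qed.

Lemma harmonic_unbounded (R : numFieldType) (n : nat) :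
  exists K, n%:R <= \sum_(1 <= k < K.+1) k%:R^-1 :> R.
Proof.
suff pow2 i : i%:R / 2 <= \sum_(1 <= k < (2 ^ i).+1) k%:R^-1 :> R.
  exists (2 ^ (n * 2))%N; apply: le_trans (pow2 _).
  by rewrite natrM mulfK ?pnatr_eq0.
elim: i => [|i IHi].
  by rewrite mul0r big_nat1 invr_ge0 ler0n.
rewrite (big_cat_nat (n := (2 ^ i).+1)) //=; last by rewrite ltnS leq_exp2l.
rewrite -natr1 mulrDl lerD // mul1r.
apply: le_trans (_ : \sum_((2 ^ i).+1 <= k < (2 ^ i.+1).+1) (2 ^ i.+1)%:R^-1 <= _).
  rewrite sumr_const_nat subSS -[leRHS]mulr_natr.
  rewrite (_ : 2 ^ i.+1 - 2 ^ i = 2 ^ i)%N; last by rewrite expnS; lia.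
  by rewrite expnS natrM [in leRHS]invfM -mulrA mulVf ?mulr1 ?pnatr_eq0 ?expn_eq0.
apply: ler_sum_nat => k /andP[k_gt k_le].
by rewrite lef_pV2 ?posrE ?ltr0n ?expn_gt0 ?ler_nat // (leq_ltn_trans _ k_gt).
Qed.

(** The integers N k + 1 alone contribute at least 1/N times the harmonic
    series. *)
Lemma coprime_harmonic_unbounded (R : numFieldType) (N n : nat) : (0 < N)%N ->
  exists K, n%:R <= \sum_(1 <= k < K.+1) (coprime k N)%:R / k%:R :> R.
Proof.
move=> N_gt0; have [K hK] := harmonic_unbounded R (n * N).
exists (N * K)%N.
suff : (\sum_(1 <= k < K.+1) k%:R^-1) / N%:R
    <= \sum_(1 <= k < (N * K).+1) (coprime k N)%:R / k%:R :> R.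
  apply: le_trans; rewrite ler_pdivlMr ?ltr0n // -natrM //.
elim: {n hK} K => [|K IHK]; first by rewrite !big_geq ?muln0 // mul0r.
rewrite big_nat_recr //= mulrDl.
rewrite [leRHS](big_cat_nat (n := (N * K).+1)) //=; last by lia.
apply: lerD => //; rewrite big_ltn; last by lia.
rewrite -[leLHS]addr0 lerD //; last first.
  by apply: sumr_ge0 => k _; rewrite divr_ge0 ?ler0n.
rewrite (_ : coprime (N * K).+1 N); last first.
  by rewrite coprime_sym -addn1 mulnC /coprime gcdnMDl gcdn1.
rewrite mul1r -invfM -natrM lef_pV2 ?posrE ?ltr0n ?muln_gt0 ?addn1 //.
by rewrite ler_nat; lia.
Qed.

Definition squarefree (n : nat) := forall p, prime p -> ~~ (p ^ 2 %| n)%N.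

Lemma squarefreeP n : (0 < n)%N ->
  squarefree n \/ exists p, prime p /\ (p ^ 2 %| n)%N.
Proof.
move=> n_gt0; have [/hasP[p p_n p2n] | /hasPn no_p] :=
  boolP (has (fun p => p ^ 2 %| n)%N (primes n)).
  by right; exists p; move: p_n; rewrite mem_primes => /andP[].
left=> p p_pr; apply/negP => p2n; suff /no_p : p \in primes n by rewrite p2n.
by rewrite mem_primes p_pr n_gt0 (dvdn_trans _ p2n) ?dvdn_exp.
Qed.

Lemma squarefree_part n : (0 < n)%N -> exists s k, [/\ n = (s * k ^ 2)%N,
  squarefree s & forall p, prime p -> (p %| s)%N -> odd (logn p n)].
Proof.
have [n0] := ubnP n; elim: n0 => // n0 IH in n *; move=> lt_n n_gt0.
have [sq_n | [p [p_pr p2n]]] := squarefreeP n_gt0; last first.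
  have p2_gt0 : (0 < p ^ 2)%N by rewrite expn_gt0 prime_gt0.
  have n'_gt0 : (0 < n %/ p ^ 2)%N by rewrite divn_gt0 // dvdn_leq.
  have [|s [k [nE sq_s odd_s]]] := IH (n %/ p ^ 2)%N _ n'_gt0.
    apply: leq_trans (_ : n <= n0)%N => //.
    by rewrite ltn_Pdiv // -mulnn; have := prime_gt1 p_pr; nia.
  exists s, (k * p)%N; split=> //.
    by rewrite expnMn mulnA -nE divnK.
  move=> p' p'_pr p's; have := odd_s p' p'_pr p's.
  by rewrite logn_div // lognX oddB ?oddM ?andbF ?addbF // -lognX dvdn_leq_log.
exists n, 1%N; split=> // [|p p_pr p_n]; first by rewrite muln1.
have := sq_n p p_pr; rewrite pfactor_dvdn //.
have : (0 < logn p n)%N by rewrite logn_gt0 mem_primes p_pr n_gt0.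
by case: logn => [|[|]].
Qed.

(** * A squarefree integer with prescribed quadratic characters *)

Lemma realchar_prod (I : Type) (s : seq I) (P : pred I) (q : I -> nat)
    (f : I -> nat -> int) : (forall i, P i -> realchar (q i) (f i)) ->
  realchar (\prod_(i <- s | P i) q i) (fun a => \prod_(i <- s | P i) f i a).
Proof.
move=> rf; elim: s => [|i s IHs].
  split=> [|a b|a|a]; rewrite ?big_nil ?expr1n ?coprimen1 //.
case Pi: (P i); last first.
  have [h1 h2 h3 h4] := IHs.
  by split=> [|a b|a|a]; rewrite !big_cons !Pi.
have [h1 h2 h3 h4] := realchar_mul (rf i Pi) IHs.
by split=> [|a b|a|a]; rewrite !big_cons Pi.
Qed.

Lemma realchar_sum_real (R : rcfType) N f m n :
  (0 < N)%N -> realchar N f -> nonprincipal f ->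
  `|\sum_(m <= a < n) (f a)%:~R| <= (N + N)%:R :> R.
Proof.
move=> N_gt0 rf npf; rewrite -rmorph_sum /= -intr_norm pmulrn ler_int -natz.
exact: realchar_sum_le.
Qed.

Lemma realchar_cube N f a : realchar N f -> f a ^+ 3 = f a.
Proof.
move=> rf; rewrite exprS (realchar_sqr rf).
by have [_ | /(realchar0 rf)->] := boolP (coprime a N); rewrite ?mulr1 ?mul0r.
Qed.

(** Here chi = [charprod] is the product of a character e modulo M with
    nontrivial characters psi i modulo pairwise coprime q i. For a subset J of
    the indices, [alpha J] is the product of the psi i with i in J, made to
    vanish off the integers prime to N, and [beta J] is its product with chi.
    If e is trivial then chi is one of the products of the psi i, so the values
    delta i can be prescribed only under the condition that their product is 1:
    this is the product formula for genus characters. *)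
Section ClassExistence.
Variables (M r : nat) (e : nat -> int) (q : 'I_r -> nat)
  (psi : 'I_r -> nat -> int) (delta : 'I_r -> int).
Hypotheses (M_gt0 : (0 < M)%N) (q_gt0 : forall i, (0 < q i)%N)
  (coMq : forall i, coprime M (q i))
  (coq : forall i j, i != j -> coprime (q i) (q j))
  (e_real : realchar M e) (psi_real : forall i, realchar (q i) (psi i))
  (psi_np : forall i, nonprincipal (psi i))
  (delta_sign : forall i, delta i = 1 \/ delta i = -1)
  (compat : nonprincipal e \/ e =1 trivchar M /\ \prod_i delta i = 1).

Definition charprod a := e a * \prod_i psi i a.

Let N := (M * \prod_i q i)%N.
Let alpha (J : {set 'I_r}) a :=
  trivchar M a * \prod_i (if i \in J then psi i else trivchar (q i)) a.
Let beta (J : {set 'I_r}) a :=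
  e a * \prod_i (if i \in J then trivchar (q i) else psi i) a.

Let Q_gt0 (P : pred 'I_r) : (0 < \prod_(i | P i) q i)%N.
Proof. by rewrite prodn_gt0. Qed.

Let N_gt0 : (0 < N)%N. Proof. by rewrite muln_gt0 M_gt0 Q_gt0. Qed.

Let q_dvd i : (q i %| N)%N.
Proof. by rewrite /N (bigD1 i) //= mulnCA dvdn_mulr. Qed.

Let coMQ (P : pred 'I_r) : coprime M (\prod_(i | P i) q i).
Proof.
by apply: (big_ind (coprime M)) => *; rewrite ?coprimen1 ?coprimeMr //; apply/andP.
Qed.

Let if_real (J : {set 'I_r}) i :
  realchar (q i) (if i \in J then psi i else trivchar (q i)).
Proof. by case: ifP => _; [exact: psi_real | exact: trivchar_real]. Qed.

Let if_real' (J : {set 'I_r}) i :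
  realchar (q i) (if i \in J then trivchar (q i) else psi i).
Proof. by case: ifP => _; [exact: trivchar_real | exact: psi_real]. Qed.

Let alpha_real J : realchar N (alpha J).
Proof. by apply: realchar_mul; [exact: trivchar_real | exact: realchar_prod]. Qed.

Let beta_real J : realchar N (beta J).
Proof. by apply: realchar_mul => //; exact: realchar_prod. Qed.

Lemma charprod_real : realchar N charprod.
Proof. by apply: realchar_mul => //; exact: realchar_prod. Qed.

Let prod_np (f : 'I_r -> nat -> int) i : (forall j, realchar (q j) (f j)) ->
  nonprincipal (f i) -> nonprincipal (fun a => \prod_j f j a).
Proof.
move=> f_real np_i.
have co_i : coprime (q i) (\prod_(j | j != i) q j).
  apply: (big_ind (coprime (q i))) => [|x y hx hy|j ji]; rewrite ?coprimen1 //.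
    by rewrite coprimeMr hx.
  by rewrite coq // eq_sym.
have [u hu] := nonprincipal_mull (q_gt0 i) (Q_gt0 _) co_i (f_real i)
  (realchar_prod (index_enum _) (fun j (_ : j != i) => f_real j)) np_i.
by exists u; rewrite (bigD1 i).
Qed.

Let alpha_np (J : {set 'I_r}) i : i \in J -> nonprincipal (alpha J).
Proof.
move=> iJ; apply: (nonprincipal_mulr M_gt0 (Q_gt0 _) (coMQ _)) => //.
- exact: trivchar_real.
- exact: realchar_prod.
by apply: (prod_np (i := i)) => //; rewrite iJ.
Qed.

Let beta_np (J : {set 'I_r}) :
  nonprincipal e \/ (exists i, i \notin J) -> nonprincipal (beta J).
Proof.
case=> [np_e | [i iJ]].
  apply: (nonprincipal_mull M_gt0 (Q_gt0 xpredT) (coMQ _)) => //.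
  exact: realchar_prod.
apply: (nonprincipal_mulr M_gt0 (Q_gt0 _) (coMQ _)) => //.
- exact: realchar_prod.
by apply: (prod_np (i := i)) => //; rewrite (negbTE iJ).
Qed.

Let twist d := \prod_i (1 + delta i * psi i d).

(** The product of the 1 + delta i * psi i d expands into the sum over all J, and
    psi i (a b) psi i b = psi i a for b prime to q i. *)
Let conv_sum d : (0 < d)%N ->
  \sum_(J : {set 'I_r}) (\prod_(i in J) delta i) *
     \sum_(b <- divisors d) alpha J (d %/ b)%N * beta J b
  = trivchar N d * charsum charprod d * twist d.
Proof.
move=> d_gt0; under eq_bigr => J _ do rewrite mulr_sumr.
rewrite exchange_big /= /charsum mulr_sumr mulr_suml big_seq [RHS]big_seq.
apply: eq_bigr => b; rewrite -dvdn_divisors // => /dvdnP[a dE].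
have b_gt0 : (0 < b)%N by move: d_gt0; rewrite dE muln_gt0 => /andP[].
rewrite dE mulnK //.
transitivity (trivchar M a * e b *
  \prod_i (delta i * psi i a * trivchar (q i) b + trivchar (q i) a * psi i b)).
  rewrite bigA_distr mulr_sumr; apply: eq_bigr => J _.
  rewrite /alpha /beta mulrACA [LHS]mulrCA; congr (_ * _).
  rewrite [X in X * _ = _]big_mkcond -!big_split /=; apply: eq_bigr => i _.
  by case: ifP => _; rewrite ?mul1r // mulrA.
rewrite /trivchar -(realchar_sqr charprod_real) -(realchar_sqr e_real).
rewrite /charprod /twist (realcharM e_real).
under eq_bigr => i _ do
  rewrite -(realchar_sqr (psi_real i) a) -(realchar_sqr (psi_real i) b).
under [in RHS]eq_bigr => i _ do rewrite (realcharM (psi_real i)).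
under [X in _ = _ * _ * X]eq_bigr => i _ do rewrite (realcharM (psi_real i)).
rewrite !exprMn -!prodrXl -{1}(realchar_cube b e_real).
transitivity (e a ^+ 2 * e b ^+ 3 * \prod_i ((psi i a * psi i b) ^+ 2 * psi i b
    * (1 + delta i * (psi i a * psi i b)))); last first.
  by rewrite !big_split /=; ring.
congr (_ * _); apply: eq_bigr => i _.
have ca := realchar_cube a (psi_real i); have cb := realchar_cube b (psi_real i).
transitivity (delta i * psi i a ^+ 3 * (psi i b ^+ 3 * psi i b)
  + psi i a ^+ 2 * psi i b ^+ 3); first by rewrite ca cb.
by ring.
Qed.

Let R : rcfType := realalg.

Let T J K : R := \sum_(1 <= a < (K ^ 2).+1)
  \sum_(1 <= b < (K ^ 2).+1 | (a * b <= K ^ 2)%N)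
    (alpha J a)%:~R * (beta J b)%:~R * invsqrt R (a * b).

Let TE J K : T J K = \sum_(1 <= d < (K ^ 2).+1)
  (\sum_(b <- divisors d) alpha J (d %/ b)%N * beta J b)%:~R * invsqrt R d.
Proof.
rewrite /T (sum_by_product (K ^ 2) (fun a b => (alpha J a)%:~R
  * (beta J b)%:~R * invsqrt R (a * b))).
apply: eq_big_nat => d /andP[d_gt0 _]; rewrite rmorph_sum /= mulr_suml.
rewrite big_seq [RHS]big_seq; apply: eq_bigr => b; rewrite -dvdn_divisors // => b_d.
by rewrite divnK // intrM.
Qed.

Let bound := ((N + N) ^ 2 + 4 * (N + N))%N.

Let T_bound J K : J != set0 -> nonprincipal e \/ J != setT -> `|T J K| <= bound%:R.
Proof.
move=> /set0Pn[i iJ] np_beta.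
have alpha_npJ := alpha_np iJ.
have beta_npJ : nonprincipal (beta J).
  apply: beta_np; case: np_beta => [|J_neqT]; [by left | right].
  apply/existsP; move: J_neqT; apply: contraNT; rewrite negb_exists => /forallP allJ.
  by apply/eqP/setP => j; rewrite inE; have := allJ j; rewrite negbK.
rewrite /bound natrD natrM natrX.
apply: hyperbola_bound => [m n|m n|a|a].
- exact: realchar_sum_real (alpha_real J) alpha_npJ.
- exact: realchar_sum_real (beta_real J) beta_npJ.
- by rewrite -intr_norm -[1]/(1%:~R) ler_int (realchar_le1 _ (alpha_real J)).
- by rewrite -intr_norm -[1]/(1%:~R) ler_int (realchar_le1 _ (beta_real J)).
Qed.

Let alpha0 a : alpha set0 a = trivchar N a.
Proof.
rewrite /trivchar -(realchar_sqr charprod_real) /charprod exprMn (realchar_sqr e_real).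
rewrite -prodrXl; congr (_ * _); apply: eq_bigr => i _.
by rewrite inE (realchar_sqr (psi_real i)).
Qed.

Let beta0 b : beta set0 b = charprod b.
Proof. by congr (_ * _); apply: eq_bigr => i _; rewrite inE. Qed.

Let conv0 d : (0 < d)%N ->
  \sum_(b <- divisors d) alpha set0 (d %/ b)%N * beta set0 b
  = trivchar N d * charsum charprod d.
Proof.
move=> d_gt0; rewrite /charsum mulr_sumr big_seq [RHS]big_seq.
apply: eq_bigr => b; rewrite -dvdn_divisors // => /dvdnP[a dE].
have b_gt0 : (0 < b)%N by move: d_gt0; rewrite dE muln_gt0 => /andP[].
rewrite dE mulnK // alpha0 beta0 /trivchar -!(realchar_sqr charprod_real).
rewrite (realcharM charprod_real) -{1}(realchar_cube b charprod_real); ring.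
Qed.

Let T0_ge K :
  \sum_(1 <= k < K.+1) (coprime k N)%:R / k%:R <= T set0 K.
Proof.
pose F d : R := (trivchar N d * charsum charprod d)%:~R * invsqrt R d.
have F_ge0 d : (0 < d)%N -> 0 <= F d.
  move=> d_gt0; rewrite mulr_ge0 ?invsqrt_ge0 // ler0z mulr_ge0 ?ler0n //.
  exact: charsum_ge0 charprod_real d_gt0.
have -> : T set0 K = \sum_(1 <= d < (K ^ 2).+1) F d.
  by rewrite TE; apply: eq_big_nat => d /andP[d_gt0 _]; rewrite conv0.
apply: le_trans (sum_squares_le K F_ge0).
apply: ler_sum_nat => k /andP[k_gt0 _].
rewrite /F invsqrt_sqr ler_wpM2r ?invr_ge0 ?ler0n //.
rewrite /trivchar coprime_pexpl //.
have [_ | _] := boolP (coprime k N); last by rewrite /= mul0r.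
by rewrite /= mul1r -[1%:R]/(1%:~R) ler_int (charsum_square_ge1 charprod_real).
Qed.

(** If e is trivial, the full set of indices gives the same pair of characters
    as the empty one, in the other order. *)
Let T_full K : e =1 trivchar M -> T setT K = T set0 K.
Proof.
move=> eE; rewrite /T (exchange_big_dep_nat xpredT) //=.
apply: eq_bigr => b _; apply: eq_big => [a | a _]; first by rewrite mulnC.
rewrite (_ : alpha setT a = beta set0 a); last first.
  by rewrite /alpha /beta -eE; congr (_ * _); apply: eq_bigr => i _; rewrite !inE.
rewrite (_ : beta setT b = alpha set0 b); last first.
  by rewrite /alpha /beta eE; congr (_ * _); apply: eq_bigr => i _; rewrite !inE.
by rewrite mulnC [X in X * _]mulrC.
Qed.

(** If no d <= K^2 qualified, the sum over J of the T J K with signs would vanish.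
    The term of the empty set exceeds any bound for large K, the term of the
    full set is nonnegative when it is not bounded, and all others are bounded. *)
Lemma exists_squarefree_in_class : exists s, [/\ (0 < s)%N /\ squarefree s,
  coprime s N, forall i, psi i s = delta i
  & forall p, prime p -> (p %| s)%N -> charprod p = 1].
Proof.
suff [d [d_gt0 co_dN sum_neq0 psi_d]] : exists d, [/\ (0 < d)%N, coprime d N,
    charsum charprod d != 0 & forall i, psi i d = delta i].
  have [s [k [dE sq_s odd_s]]] := squarefree_part d_gt0.
  have co_s : coprime s N by move: co_dN; rewrite dE coprimeMl => /andP[].
  have co_k : coprime k N.
    by move: co_dN; rewrite dE coprimeMl coprime_pexpl // => /andP[].
  exists s; split=> //.
  - by split=> //; move: d_gt0; rewrite dE muln_gt0 => /andP[].
  - move=> i; rewrite -psi_d dE (realcharM (psi_real i)) (realcharX _ _ (psi_real i)).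
    rewrite (realchar_sqr (psi_real i)); suff -> : coprime k (q i) by rewrite mulr1.
    exact: coprime_dvdr (q_dvd i) co_k.
  move=> p p_pr p_s; have odd_p := odd_s p p_pr p_s.
  have np := charsum_neq0_odd charprod_real p_pr d_gt0 sum_neq0 odd_p.
  by have [|//] := realchar_coprime charprod_real (coprime_dvdl p_s co_s).
pose good d := [&& coprime d N, charsum charprod d != 0
                 & [forall i, psi i d == delta i]].
(* All terms but that of the empty set add up to at least -C. *)
pose C := (#|{set 'I_r}| * bound)%N.
have [K hK] := coprime_harmonic_unbounded R C.+1 N_gt0.
have [/hasP[d] | /hasPn no_good] := boolP (has good (index_iota 1 (K ^ 2).+1)).
  rewrite mem_index_iota => /andP[d_gt0 _] /and3P[co_d sum_d /forallP psi_d].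
  by exists d; split=> // i; apply/eqP.
have sign_prod (P : pred 'I_r) : `|\prod_(i | P i) delta i| = 1.
  rewrite normr_prod big1 // => i _.
  by case: (delta_sign i) => ->.
have sum0 : \sum_(J : {set 'I_r}) (\prod_(i in J) delta i)%:~R * T J K = 0.
  under eq_bigr => J _ do rewrite TE mulr_sumr.
  rewrite exchange_big big_nat big1 //= => d d_in.
  under eq_bigr => J _ do rewrite mulrA -intrM.
  have /andP[d_gt0 _] := d_in.
  rewrite -mulr_suml -rmorph_sum /= conv_sum //.
  suff -> : trivchar N d * charsum charprod d * twist d = 0 by rewrite mul0r.
  have : ~~ good d by apply: no_good; rewrite mem_index_iota.
  rewrite /good /trivchar; have [co_d | _] := boolP (coprime d N); last by rewrite !mul0r.
  have [-> | _] := eqVneq (charsum charprod d) 0; first by rewrite mulr0 mul0r.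
  rewrite /= negb_forall => /existsP[i psi_i].
  rewrite /twist (bigD1 i) //= (_ : 1 + delta i * psi i d = 0) ?mul0r ?mulr0 //.
  have [] : psi i d = 1 \/ psi i d = -1.
  - apply: realchar_coprime (psi_real i) _.
    exact: coprime_dvdr (q_dvd i) co_d.
  - by move=> E; move: psi_i; rewrite E; case: (delta_sign i) => ->.
  - by move=> E; move: psi_i; rewrite E; case: (delta_sign i) => ->.
have T0_le : T set0 K <= C%:R.
  move: sum0; rewrite (bigD1 set0) //= big_set0 mul1r => /eqP.
  rewrite addr_eq0 => /eqP ->.
  rewrite -sumrN.
  apply: (@le_trans _ _ (\sum_(J : {set 'I_r}) bound%:R)); last first.
    by rewrite sumr_const /C mulnC natrM mulr_natr.
  rewrite [leRHS](bigD1 set0) //= ler_wpDl ?ler0n //.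
  apply: ler_sum => J J_neq0.
  have by_norm : `|T J K| <= bound%:R ->
      - ((\prod_(i in J) delta i)%:~R * T J K) <= bound%:R.
    move=> le_T; apply: le_trans (ler_norm _) _.
    by rewrite normrN normrM -intr_norm sign_prod mul1r.
  case: compat => [np_e | [e_triv delta1]].
    by apply/by_norm/T_bound => //; left.
  have [JT | J_neqT] := eqVneq J setT; last by apply/by_norm/T_bound => //; right.
  rewrite JT T_full // (_ : \prod_(i in setT) delta i = 1); last first.
    by rewrite -[RHS]delta1; apply: eq_bigl => i; rewrite inE.
  rewrite mul1r; apply: (@le_trans _ _ 0) => //; rewrite oppr_le0.
  apply: le_trans (T0_ge K); apply: sumr_ge0 => k _.
  by rewrite divr_ge0 ?ler0n.
by have := le_trans hK (le_trans (T0_ge K) T0_le); rewrite ler_nat ltnn.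
Qed.

End ClassExistence.

(** * The quadratic character of a finite field *)

Definition quad_char (F : finFieldType) (x : F) : int :=
  if x == 0 then 0 else if [exists y : F, y ^+ 2 == x] then 1 else -1.

Section QuadChar.
Variable F : finFieldType.
Hypothesis oddF : odd #|F|.

Lemma prim_generator : exists z : F, #|F|.-1.-primitive_root z.
Proof.
have cardF : (1 < #|F|)%N := finNzRing_gt1 F.
have /hasP[z _ z_prim] :
    has #|F|.-1.-primitive_root (enum (predC1 (0 : F))); last by exists z.
apply: has_prim_root.
- by rewrite -ltnS prednK // ltnW.
- apply/allP => x; rewrite mem_enum inE /= => x_neq0; rewrite unity_rootE.
  rewrite -(inj_eq (mulfI x_neq0)) -exprS prednK ?(ltnW cardF) //.
  by rewrite expf_card mulr1.
- exact: enum_uniq.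
- by rewrite -cardE cardC1.
Qed.

Variable z : F.
Hypothesis z_prim : #|F|.-1.-primitive_root z.

Lemma generatorP (x : F) : x != 0 -> exists i, x = z ^+ i.
Proof.
have cardF : (1 < #|F|)%N := finNzRing_gt1 F.
move=> x_neq0; have [|i ->] := prim_rootP z_prim (x := x); last by exists i.
by apply: (mulfI x_neq0); rewrite -exprS prednK ?(ltnW cardF) // expf_card mulr1.
Qed.

Lemma generator_neq0 i : z ^+ i != 0.
Proof.
have cardF : (1 < #|F|)%N := finNzRing_gt1 F.
rewrite expf_neq0 //; apply/eqP => z0; have := prim_expr_order z_prim.
have : (0 < #|F|.-1)%N by rewrite -ltnS prednK // ltnW.
by rewrite z0 expr0n; case: (#|F|.-1) => // n _ /eqP; rewrite eq_sym oner_eq0.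
Qed.

(** The order of z is even, so the parity of an exponent of z is well defined. *)
Lemma quad_char_generator i : quad_char (z ^+ i) = (-1) ^+ i.
Proof.
have cardF : (1 < #|F|)%N := finNzRing_gt1 F.
rewrite /quad_char (negbTE (generator_neq0 i)) -signr_odd.
case: existsP => [[y /eqP y2] | no_root].
  have [j yE] : exists j, y = z ^+ j.
    apply: generatorP; apply: contraTneq (generator_neq0 i) => y0.
    by rewrite -y2 y0 expr0n eqxx.
  move/eqP: y2; rewrite yE -exprM (eq_prim_root_expr z_prim) => /eqP eq_ji.
  suff -> : odd i = false by [].
  have even_n : ~~ odd #|F|.-1 by move: oddF; rewrite -{1}(prednK (ltnW cardF)).
  have odd_mod k : odd (k %% #|F|.-1) = odd k by rewrite odd_mod //; apply/negbTE.
  by rewrite -odd_mod -eq_ji odd_mod oddM andbF.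
have [// | even_i] := boolP (odd i); case: no_root; exists (z ^+ i./2).
by rewrite -exprM muln2 -[X in _ == z ^+ X]odd_double_half (negbTE even_i).
Qed.

End QuadChar.

Section QuadCharTheory.
Variable F : finFieldType.
Hypothesis oddF : odd #|F|.
Implicit Types x y : F.

Lemma quad_char0 : quad_char (0 : F) = 0. Proof. by rewrite /quad_char eqxx. Qed.

Lemma quad_char1 : quad_char (1 : F) = 1.
Proof.
have [z zP] := prim_generator F.
by rewrite -(expr0 z) (quad_char_generator oddF zP) expr0.
Qed.

Lemma quad_charM x y : quad_char (x * y) = quad_char x * quad_char y.
Proof.
have [-> | x_neq0] := eqVneq x 0; first by rewrite mul0r quad_char0 mul0r.
have [-> | y_neq0] := eqVneq y 0; first by rewrite mulr0 quad_char0 mulr0.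
have [z zP] := prim_generator F.
have [i ->] := generatorP zP x_neq0; have [j ->] := generatorP zP y_neq0.
by rewrite -exprD !(quad_char_generator oddF zP) exprD.
Qed.

Lemma quad_char_sqr x : quad_char x ^+ 2 = (x != 0)%:R.
Proof.
by rewrite /quad_char; case: eqP => // _; case: existsP.
Qed.

Lemma quad_char_nonsquare : exists x : F, quad_char x = -1.
Proof.
have [z zP] := prim_generator F; exists z.
by rewrite -[z]expr1 (quad_char_generator oddF zP) expr1.
Qed.

Lemma quad_char_sum0 : \sum_(x : F) quad_char x = 0.
Proof.
have [u hu] := quad_char_nonsquare.
have u_neq0 : u != 0 by apply/eqP => u0; move: hu; rewrite u0 quad_char0.
have : \sum_(x : F) quad_char x = - \sum_(x : F) quad_char x.
  rewrite {1}(reindex_inj (mulfI u_neq0)) /= -sumrN; apply: eq_bigr => x _.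
  by rewrite quad_charM hu mulN1r.
by move: (\sum_x _) => S; lia.
Qed.
End QuadCharTheory.

Definition legendre (p a : nat) : int := quad_char (a%:R : 'F_p).

Lemma legendre_real p : prime p -> odd p -> realchar p (legendre p).
Proof.
move=> p_pr odd_p; have odd_Fp : odd #|'F_p| by rewrite card_Fp.
split=> [|a b|a|a]; rewrite /legendre.
- exact: quad_char1.
- by rewrite natrM quad_charM.
- by rewrite Fp_nat_mod.
- rewrite quad_char_sqr -(dvdn_pcharf (pchar_Fp p_pr)).
  by rewrite coprime_sym prime_coprime.
Qed.

Lemma legendre_nonprincipal p : prime p -> odd p -> nonprincipal (legendre p).
Proof.
move=> p_pr odd_p; have odd_Fp : odd #|'F_p| by rewrite card_Fp.
have [u hu] := quad_char_nonsquare odd_Fp; exists u.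
by rewrite /legendre natr_Zp.
Qed.

(** * Quadratic Gauss sums *)

Section GaussSum.
Variables (p : nat) (L : fieldType) (w : L).
Hypotheses (p_pr : prime p) (odd_p : odd p) (w_prim : p.-primitive_root w).

Let add_char (x : 'F_p) : L := w ^+ (x : nat).

Let add_charD x y : add_char (x + y) = add_char x * add_char y.
Proof.
rewrite /add_char -exprD -[RHS](prim_expr_mod w_prim); congr (w ^+ _).
by congr (_ %% _)%N; apply: Fp_cast.
Qed.

Let add_char_nat x n : add_char (n%:R * x) = add_char x ^+ n.
Proof.
elim: n => [|n IHn]; first by rewrite mul0r /add_char !expr0.
by rewrite -natr1 mulrDl mul1r add_charD IHn exprSr.
Qed.

Let add_char_sum0 : \sum_x add_char x = 0.
Proof.
have e1 : add_char 1 != 1.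
  rewrite /add_char (_ : (1 : 'F_p) = 1%N :> nat); last by rewrite /= modn_small.
  rewrite -(prim_order_dvd w_prim) dvdn1.
  by rewrite neq_ltn prime_gt1 ?orbT.
apply/eqP; have : \sum_x add_char x = add_char 1 * \sum_x add_char x.
  rewrite {1}(reindex_inj (addrI 1)) mulr_sumr.
  by apply: eq_bigr => x _; rewrite add_charD.
move/eqP; rewrite -subr_eq0 -{1}[\sum_x _]mul1r -mulrBl mulf_eq0 subr_eq0.
by rewrite eq_sym (negbTE e1).
Qed.

Let add_char_sum_mul (c : 'F_p) :
  \sum_x add_char (x * c) = (if c == 0 then p%:R else 0).
Proof.
case: eqP => [-> | /eqP c_neq0].
  under eq_bigr => x _ do rewrite mulr0 /add_char expr0.
  by rewrite sumr_const card_Fp.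
by rewrite -[RHS]add_char_sum0 [RHS](reindex_inj (mulIf c_neq0)).
Qed.

Definition gauss_sum : L := \sum_(x : 'F_p) (quad_char x)%:~R * w ^+ (x : nat).

Let odd_Fp : odd #|'F_p|. Proof. by rewrite card_Fp. Qed.

(** Substituting y = x c in the double sum over x and y leaves, for each c, a sum
    over x <> 0 of an additive character, which is p - 1 for c = -1 and -1
    otherwise. *)
Lemma gauss_sum_sqr : gauss_sum ^+ 2 = (quad_char (-1 : 'F_p) * p%:Z)%:~R.
Proof.
rewrite expr2 {1}/gauss_sum mulr_suml.
transitivity (\sum_(x : 'F_p) \sum_(c : 'F_p)
    (if x == 0 then 0 else (quad_char c)%:~R * add_char (x * (1 + c)))).
  apply: eq_bigr => x _.
  case: eqP => [-> | /eqP x_neq0]; first by rewrite quad_char0 big1 ?mul0r.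
  rewrite /gauss_sum mulr_sumr (reindex_inj (mulfI x_neq0)) /=.
  apply: eq_bigr => c _; rewrite mulrACA -intrM -/(add_char x) -/(add_char (x * c)).
  rewrite -add_charD mulrDr mulr1 (quad_charM odd_Fp) mulrA -expr2.
  by rewrite quad_char_sqr x_neq0 mul1r.
rewrite exchange_big /=.
transitivity (\sum_(c : 'F_p) (quad_char c)%:~R * ((if 1 + c == 0 then p%:R else 0) - 1 : L)).
  apply: eq_bigr => c _; rewrite -add_char_sum_mul.
  rewrite (bigD1 0) //= add0r [X in _ = _ * (X - _)](bigD1 0) //= mul0r.
  rewrite {2}/add_char expr0 addrAC subrr add0r mulr_sumr.
  by apply: eq_bigr => x /negbTE ->.
under eq_bigr => c _ do rewrite mulrBr mulr1.
rewrite big_split /= sumrN -rmorph_sum /= (quad_char_sum0 odd_Fp) subr0.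
rewrite (bigD1 (-1)) //= subrr eqxx big1 ?addr0 ?intrM // => c c_neq.
by rewrite addrC addr_eq0 (negbTE c_neq) mulr0.
Qed.

Lemma gauss_sum_frobenius l : l \in [pchar L] -> odd l -> coprime l p ->
  gauss_sum ^+ l = (legendre p l)%:~R * gauss_sum.
Proof.
move=> charl odd_l co_lp.
have l_neq0 : (l%:R : 'F_p) != 0.
  by rewrite -(dvdn_pcharf (pchar_Fp p_pr)) -prime_coprime // coprime_sym.
have sign_l (x : 'F_p) : quad_char x ^+ l = quad_char x.
  rewrite /quad_char; case: eqP => _; first by rewrite expr0n gtn_eqF ?odd_gt0.
  by case: ifP => _; rewrite ?expr1n // -signr_odd odd_l.
rewrite -(pFrobenius_autE charl) rmorph_sum mulr_sumr /=.
rewrite [RHS](reindex_inj (mulfI l_neq0)) /=; apply: eq_bigr => x _.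
rewrite pFrobenius_autE exprMn -rmorphXn /= sign_l -/(add_char x) -/(add_char (l%:R * x)).
rewrite add_char_nat mulrA -intrM (quad_charM odd_Fp) /legendre mulrA -expr2.
by rewrite quad_char_sqr l_neq0 mul1r.
Qed.
End GaussSum.

(** * Quadratic reciprocity *)

(** In every field of odd characteristic l prime to N that contains the N-th
    roots of unity, k has a square root which the Frobenius map multiplies by
    f l. This is the reciprocity law for k, in a form that is stable under
    products. *)
Definition sqrt_character (N : nat) (f : nat -> int) (k : int) :=
  forall (L : fieldType) (l : nat) (w : L),
    l \in [pchar L] -> odd l -> coprime l N -> N.-primitive_root w ->
  exists theta : L, theta ^+ 2 = k%:~R /\ theta ^+ l = (f l)%:~R * theta.

Lemma sqrt_character_mul M N f g k m :
  sqrt_character M f k -> sqrt_character N g m ->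
  sqrt_character (M * N) (fun a => f a * g a) (k * m).
Proof.
move=> hf hg L l w charL odd_l; rewrite coprimeMr => /andP[co_M co_N] w_prim.
have := prim_order_gt0 w_prim; rewrite muln_gt0 => /andP[M_gt0 N_gt0].
have wM := dvdn_prim_root w_prim (dvdn_mulr N (dvdnn M)).
have wN := dvdn_prim_root w_prim (dvdn_mull M (dvdnn N)).
have [s [s2 sl]] := hf L l _ charL odd_l co_M wM.
have [t [t2 tl]] := hg L l _ charL odd_l co_N wN.
exists (s * t); split; first by rewrite exprMn s2 t2 intrM.
by rewrite exprMn sl tl intrM mulrACA.
Qed.

Lemma sqrt_character_prod (I : Type) (s : seq I) (q : I -> nat)
    (f : I -> nat -> int) (k : I -> int) :
    (forall i, sqrt_character (q i) (f i) (k i)) ->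
  sqrt_character (\prod_(i <- s) q i) (fun a => \prod_(i <- s) f i a)
    (\prod_(i <- s) k i).
Proof.
move=> hf; elim: s => [|i s IHs] L l w charL odd_l.
  by move=> _ _; exists 1; rewrite !big_nil expr1n expr1n mul1r.
rewrite !big_cons; exact: (sqrt_character_mul (hf i) IHs).
Qed.

Definition pstar (p : nat) : int := quad_char (-1 : 'F_p) * p%:Z.

Lemma sqrt_character_legendre p : prime p -> odd p ->
  sqrt_character p (legendre p) (pstar p).
Proof.
move=> p_pr odd_p L l w charL odd_l co_lp w_prim.
exists (gauss_sum p w); split; first exact: gauss_sum_sqr.
exact: gauss_sum_frobenius.
Qed.

Lemma frobenius_fixed (L : fieldType) (l : nat) (x : L) : l \in [pchar L] ->
  x ^+ l = x -> exists n : nat, x = n%:R.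
Proof.
move=> charL xl; have l_pr := pcharf_prime charL; have l_gt1 := prime_gt1 l_pr.
pose s : seq L := [seq i%:R | i <- iota 0 l].
have [/mapP[n _ ->] | x_notin] := boolP (x \in s); first by exists n.
have size_P : size ('X^l - 'X : {poly L}) = l.+1.
  by rewrite size_polyDl ?size_polyXn // size_polyN size_polyX.
have P_neq0 : 'X^l - 'X != 0 :> {poly L} by rewrite -size_poly_eq0 size_P.
suff : (size (x :: s) < size ('X^l - 'X : {poly L})%R)%N.
  by rewrite size_P /= size_map size_iota ltnn.
apply: max_poly_roots => //=.
  rewrite /root !hornerE xl subrr eqxx /=.
  apply/allP => y /mapP[i _ ->]; rewrite /root !hornerE.
  by rewrite -(pFrobenius_autE charL) pFrobenius_aut_nat subrr.
rewrite x_notin map_inj_in_uniq ?iota_uniq // => i j.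
rewrite !mem_iota !add0n => /andP[_ lt_i] /andP[_ lt_j] /eqP.
wlog le_ij : i j lt_i lt_j / (i <= j)%N.
  move=> W; have [le_ij | /ltnW le_ji] := leqP i j; first exact: W.
  by rewrite eq_sym => /(W _ _ lt_j lt_i le_ji).
rewrite eq_sym -subr_eq0 -natrB // -(dvdn_pcharf charL).
by case: (posnP (j - i)) => [|ji_gt0 /(dvdn_leq ji_gt0)]; lia.
Qed.

(** The field with l^phi(N) elements will do, since N divides l^phi(N) - 1. *)
Lemma exists_prim_root_pchar l N : prime l -> (0 < N)%N -> coprime l N ->
  exists (L : fieldType) (w : L), l \in [pchar L] /\ N.-primitive_root w.
Proof.
move=> l_pr N_gt0 co_lN.
have phi_gt0 : (0 < totient N)%N by rewrite totient_gt0.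
have [F charF cardF] := pPrimePowerField l_pr phi_gt0.
have [z z_prim] := prim_generator F.
exists F, (z ^+ (#|F|.-1 %/ N)); split=> //; apply: dvdn_prim_root => //.
have := Euler_exp_totient co_lN; rewrite -cardF => /eqP.
by rewrite eqn_mod_dvd ?subn1 // cardF expn_gt0 prime_gt0.
Qed.

(** The square root of k lies in the prime field exactly when it is fixed by the
    Frobenius map. *)
Lemma sqrt_character_reciprocity N f k l : sqrt_character N f k ->
    (0 < N)%N -> prime l -> odd l -> coprime l N -> ~~ (l %| k)%Z ->
    f l = 1 \/ f l = -1 -> quad_char (k%:~R : 'F_l) = f l.
Proof.
move=> hf N_gt0 l_pr odd_l co_lN l_k f_sign.
have [L [w [charL w_prim]]] := exists_prim_root_pchar l_pr N_gt0 co_lN.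
have [t [t2 tl]] := hf L l w charL odd_l co_lN w_prim.
have charF := pchar_Fp l_pr.
have sqr_transfer (K K' : fieldType) (n : nat) : l \in [pchar K] ->
    l \in [pchar K'] -> n%:R ^+ 2 = k%:~R :> K -> n%:R ^+ 2 = k%:~R :> K'.
  have nE (A : fieldType) : n%:R ^+ 2 - k%:~R = (n%:Z ^+ 2 - k)%:~R :> A.
    by rewrite rmorphB rmorphXn.
  move=> charK charK' /eqP; rewrite -subr_eq0 nE -(dvdz_pcharf charK).
  by rewrite (dvdz_pcharf charK') -nE subr_eq0 => /eqP.
rewrite /quad_char -(dvdz_pcharf charF) (negbTE l_k).
case: f_sign => fl; rewrite fl in tl *.
  have [n tn] : exists n : nat, t = n%:R.
    by apply: (frobenius_fixed charL); rewrite tl mul1r.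
  have n2 := sqr_transfer L _ n charL charF; rewrite -tn in n2.
  by case: existsP => // -[]; exists n%:R; rewrite n2.
case: existsP => // -[y /eqP]; rewrite -(natr_Zp y) => y2.
have {}y2 := sqr_transfer _ L _ charF charL y2.
have t_fix : t ^+ l = t.
  move/eqP: y2; rewrite -t2 eqf_sqr => /orP[] /eqP yt.
    by rewrite -yt -(pFrobenius_autE charL) pFrobenius_aut_nat.
  have -> : t = - y%:R by rewrite yt opprK.
  by rewrite -(pFrobenius_autE charL) rmorphN /= pFrobenius_aut_nat.
have t0 : t = 0.
  have : t * 2 = 0 by rewrite mulr_natr mulr2n -{1}t_fix tl mulN1r addNr.
  move=> /eqP; rewrite mulf_eq0 => /orP[/eqP // |].
  rewrite -(dvdn_pcharf charL) dvdn_prime2 // => /eqP l2.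
  by move: odd_l; rewrite l2.
by move: l_k; rewrite (dvdz_pcharf charL) -t2 t0 expr0n eqxx.
Qed.

(** The four real characters modulo 8, by their values (-1)^b at 3 and (-1)^c
    at 5. *)
Definition chi8 (b c : bool) (a : nat) : int :=
  nth 0 [:: 0; 1; 0; (-1) ^+ b; 0; (-1) ^+ c; 0; (-1) ^+ (b (+) c)] (a %% 8).

Lemma chi8_real b c : realchar 8 (chi8 b c).
Proof.
have mod8 a : (a %% 8 \in iota 0 8)%N by rewrite mem_iota ltn_mod.
split=> [|a a'|a|a]; rewrite /chi8 ?modn_mod //.
  rewrite -modnMm; have := mod8 a'; have := mod8 a.
  move: (a %% 8)%N (a' %% 8)%N => {a'}i j hi hj.
  have /allP/(_ i hi)/allP/(_ j hj)/eqP-> // :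
    all (fun i => all (fun j => nth 0 [:: 0; 1; 0; (-1) ^+ b; 0; (-1) ^+ c; 0;
            (-1) ^+ (b (+) c)] ((i * j) %% 8)
      == nth 0 [:: 0; 1; 0; (-1) ^+ b; 0; (-1) ^+ c; 0; (-1) ^+ (b (+) c)] i *
         nth 0 [:: 0; 1; 0; (-1) ^+ b; 0; (-1) ^+ c; 0; (-1) ^+ (b (+) c)] j :> int)
      (iota 0 8)) (iota 0 8).
  by case: b; case: c.
rewrite -coprime_modl; have := mod8 a; move: (a %% 8)%N => i hi.
have /allP/(_ i hi)/eqP-> // :
  all (fun i => nth 0 [:: 0; 1; 0; (-1) ^+ b; 0; (-1) ^+ c; 0;
            (-1) ^+ (b (+) c)] i ^+ 2 == (coprime i 8)%:R :> int) (iota 0 8).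
by case: b; case: c.
Qed.

(** The integer d among 1, -1, 2, -2 such that [chi8 b c] is the quadratic
    character of Q(sqrt d). *)
Definition disc8 (b c : bool) : int :=
  if c then (if b then 2 else -2) else (-1) ^+ b.

(** For a primitive eighth root of unity w, the square roots of -1, 2 and -2 are
    w^2, w + w^7 and w + w^3. *)
Lemma sqrt_character8 b c :
  sqrt_character 8 (chi8 b c) (disc8 b c).
Proof.
move=> L l w charL odd_l _ w_prim.
have w4 : w ^+ 4 = -1.
  have := prim_expr_order w_prim; rewrite (_ : 8 = 4 * 2)%N // exprM => /eqP.
  by rewrite sqrf_eq1 -(prim_order_dvd w_prim) => /eqP.
have frob i : (w ^+ i) ^+ l = (w ^+ (l %% 8)) ^+ i.
  by rewrite (prim_expr_mod w_prim) -!exprM mulnC.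
have frobD i j : (w ^+ i + w ^+ j) ^+ l = (w ^+ (l %% 8)) ^+ i + (w ^+ (l %% 8)) ^+ j.
  by rewrite -(pFrobenius_autE charL) rmorphD /= !pFrobenius_autE !frob.
have : (l %% 8)%N \in [:: 1; 3; 5; 7]%N.
  have : odd (l %% 8)%N by rewrite odd_mod.
  by have := ltn_pmod l (isT : 0 < 8)%N; case: (l %% 8)%N => [|[|[|[|[|[|[|[|]]]]]]]].
rewrite /chi8; move: (l %% 8)%N frob frobD => l8 frob frobD l8_in.
rewrite /disc8; case: c; case: b.
- exists (w ^+ 1 + w ^+ 7); split; first by ring: w4.
  rewrite frobD; move: l8_in; rewrite !inE.
  by case/or4P => /eqP-> /=; ring: w4.
- exists (w ^+ 1 + w ^+ 3); split; first by ring: w4.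
  rewrite frobD; move: l8_in; rewrite !inE.
  by case/or4P => /eqP-> /=; ring: w4.
- exists (w ^+ 2); split; first by ring: w4.
  rewrite frob; move: l8_in; rewrite !inE.
  by case/or4P => /eqP-> /=; ring: w4.
- exists 1; split; first by ring.
  rewrite expr1n; move: l8_in; rewrite !inE.
  by case/or4P => /eqP-> /=; ring.
Qed.

(** * Sums of three squares *)

Lemma sqr_mod_squarefree (a : int) (s : nat) : (0 < s)%N -> squarefree s ->
    (forall p, prime p -> (p %| s)%N -> exists x : int, (p %| x ^+ 2 - a)%Z) ->
  exists x : int, (s %| x ^+ 2 - a)%Z.
Proof.
have [s0] := ubnP s; elim: s0 => // s0 IH in s *; move=> lt_s s_gt0 sq_s loc.
have [s1 | s_gt1] := leqP s 1.
  by exists 0; have -> : s = 1%N by lia.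
have p_pr := pdiv_prime s_gt1; set p := pdiv s in p_pr.
have /dvdnP[s' sE] : (p %| s)%N := pdiv_dvd s.
have s'_gt0 : (0 < s')%N by move: s_gt0; rewrite sE muln_gt0 => /andP[].
have co_ps' : coprime p s'.
  rewrite prime_coprime //; apply: contra (sq_s p p_pr) => p_s'.
  by rewrite sE -mulnn dvdn_mul.
have [||p' p'_pr p'_s'|x2 hx2] := IH s' _ s'_gt0.
- by have := prime_gt1 p_pr; nia.
- move=> p' p'_pr; apply: contra (sq_s p' p'_pr) => h.
  by rewrite sE dvdn_mulr.
- by apply: loc => //; rewrite sE dvdn_mulr.
have [|x1 hx1] := loc p p_pr; first exact: pdiv_dvd.
have [[u v] /= uv1] : exists uv : int * int, uv.1 * p + uv.2 * s' = 1.
  by apply/coprimezP.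
exists (x1 * (v * s') + x2 * (u * p)).
have dvdE (m : nat) (x y z : int) : (m %| y ^+ 2 - a)%Z -> x = y + z * m ->
    (m %| x ^+ 2 - a)%Z.
  move=> hy ->.
  rewrite (_ : _ - a = (y ^+ 2 - a) + (2 * y * z + z ^+ 2 * m) * m); last ring.
  by rewrite rpredD ?dvdz_mull.
rewrite sE PoszM Gauss_dvdz; last by rewrite coprimezE coprime_sym.
apply/andP; split.
  apply: (dvdE _ _ x2 ((x1 - x2) * v)) => //.
  by rewrite -[in X in _ = X + _](mulr1 x2) -uv1; ring.
apply: (dvdE _ _ x1 ((x2 - x1) * u)) => //.
by rewrite -[in X in _ = X + _](mulr1 x1) -uv1; ring.
Qed.

(** If T^2 = -n modulo d and S^2 = -d modulo n, take s inverse to S modulo n, so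
    that n divides 1 + s^2 d; the quotient b is inverse to n modulo d, and
    (T b)^2 = -b modulo d. *)
Lemma sum3sq_of_local_squares (n d : nat) : (0 < n)%N -> (0 < d)%N ->
    coprime n d -> squarefree n -> squarefree d ->
    (forall p, prime p -> (p %| d)%N -> exists x : int, (p %| x ^+ 2 + n%:Z)%Z) ->
    (forall p, prime p -> (p %| n)%N -> exists x : int, (p %| x ^+ 2 + d%:Z)%Z) ->
  exists u v w : int, n%:Z = u ^+ 2 + v ^+ 2 + w ^+ 2.
Proof.
move=> n_gt0 d_gt0 co_nd sq_n sq_d loc_d loc_n.
have [T hT] : exists x : int, (d %| x ^+ 2 + n%:Z)%Z.
  have [//|x hx] := @sqr_mod_squarefree (- n%:Z) d d_gt0 sq_d.
    by move=> p p_pr p_d; have [x] := loc_d p p_pr p_d; exists x; rewrite opprK.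
  by exists x; rewrite opprK in hx.
have [S hS] : exists x : int, (n %| x ^+ 2 + d%:Z)%Z.
  have [//|x hx] := @sqr_mod_squarefree (- d%:Z) n n_gt0 sq_n.
    by move=> p p_pr p_n; have [x] := loc_n p p_pr p_n; exists x; rewrite opprK.
  by exists x; rewrite opprK in hx.
have co_nS : coprimez n S.
  have : coprimez n (S ^+ 2).
    have /dvdzP[k kE] := hS.
    have /coprimezP[[u v] /= uv1] : coprimez n d := co_nd.
    apply/coprimezP; exists (u + v * k, - v) => /=; rewrite -uv1.
    by rewrite (_ : d%:Z = k * n - S ^+ 2); [ring | rewrite -kE addrAC subrr add0r].
  by rewrite !coprimezE abszX coprime_pexpr.
have [[u s] /= us1] : exists us : int * int, us.1 * n + us.2 * S = 1.
  exact/coprimezP.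
have [b bn] : exists b : int, b * n = 1 + s ^+ 2 * d.
  have /dvdzP[k kE] := hS.
  exists (s ^+ 2 * k + u * (1 + s * S)).
  have -> : d%:Z = k * n - S ^+ 2 by rewrite -kE addrAC subrr add0r.
  transitivity (s ^+ 2 * (k * n) + (u * n) * (1 + s * S)); first by ring.
  have -> : u * n = 1 - s * S by rewrite -us1 addrK.
  by ring.
apply: (@sum3sq_of_residues n d s (T * b) b) => //.
have /dvdzP[k kE] := hT; apply/dvdzP; exists (k * b ^+ 2 - b * s ^+ 2).
have -> : (k * b ^+ 2 - b * s ^+ 2) * d = (k * d) * b ^+ 2 - b * (s ^+ 2 * d) by ring.
by rewrite -kE (_ : s ^+ 2 * d = b * n - 1); [ring | rewrite bn addrAC subrr add0r].
Qed.

Lemma quad_char_eq1 p (a : int) : prime p -> quad_char (a%:~R : 'F_p) = 1 ->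
  exists x : int, (p %| x ^+ 2 - a)%Z.
Proof.
move=> p_pr; rewrite /quad_char; case: eqP => // _; case: existsP => // -[y /eqP y2] _.
exists (y : nat)%:Z; rewrite (dvdz_pcharf (pchar_Fp p_pr)) rmorphB rmorphXn /=.
by rewrite -y2 -[X in _ - X ^+ 2]natr_Zp subrr.
Qed.
Lemma quad_char_N1 p : prime p -> odd p ->
  quad_char (-1 : 'F_p) = chi8 true false p.
Proof.
move=> p_pr odd_p; have co_p8 : coprime p 8.
  by rewrite (@coprime_pexpr 3 p 2) // coprimen2.
rewrite -(sqrt_character_reciprocity (sqrt_character8 true false)) //=.
- by rewrite dvdzE /= dvdn1 neq_ltn prime_gt1 ?orbT.
- exact: realchar_coprime (chi8_real _ _) co_p8.
Qed.

Lemma quad_char_N2 p : prime p -> odd p ->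
  quad_char ((-2)%:~R : 'F_p) = chi8 false true p.
Proof.
move=> p_pr odd_p; have co_p8 : coprime p 8.
  by rewrite (@coprime_pexpr 3 p 2) // coprimen2.
rewrite -(sqrt_character_reciprocity (sqrt_character8 false true)) //=.
- by rewrite dvdzE /= dvdn_prime2 //; apply: contraTneq odd_p => ->.
- exact: realchar_coprime (chi8_real _ _) co_p8.
Qed.

Lemma realchar_prodE N f (I : Type) (s : seq I) (q : I -> nat) : realchar N f ->
  f (\prod_(i <- s) q i)%N = \prod_(i <- s) f (q i).
Proof.
move=> rf; elim: s => [|i s IHs]; first by rewrite !big_nil (realchar1 rf).
by rewrite !big_cons (realcharM rf) IHs.
Qed.

(** Here n = g n' with n' odd squarefree, and b, c are such that
    [disc8 b c] times the product of the [pstar (q i)] is -n; then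
    chi p = 1 means that -n is a square modulo p. The auxiliary integer is
    d = m s. If [chi8 b c] is trivial, which happens for n = 3 modulo 4, then
    m = 2 is needed: delta i is the quadratic character of -m modulo q i, the
    product of these values for m = 2 is [chi8 false true n'], and it has to be
    1, as it is for n = 3 modulo 8. *)
Lemma sum3sq_of_class (r : nat) (q : 'I_r -> nat) (b c : bool) (g m : nat) :
    (forall i, prime (q i)) -> (forall i, odd (q i)) -> injective q ->
    let n' := (\prod_i q i)%N in
    (g == 1)%N || (g == 2)%N ->
    disc8 b c * chi8 true false n' = - g%:Z ->
    (b || c) && (m == 1%N) ||
      [&& ~~ b, ~~ c, g == 1%N, m == 2%N & chi8 false true n' == 1] ->
  exists u v w : int, (g * n')%N%:Z = u ^+ 2 + v ^+ 2 + w ^+ 2.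
Proof.
move=> q_pr q_odd q_inj n' g12 kappaE bcm.
pose delta i := quad_char ((- m%:Z)%:~R : 'F_(q i)).
have odd_F i : odd #|'F_(q i)| by rewrite card_Fp.
have co8q i : coprime 8 (q i) by rewrite (@coprime_pexpl 3 2) // coprime2n.
have coq i j : i != j -> coprime (q i) (q j).
  by move=> ij; rewrite prime_coprime // dvdn_prime2 // (inj_eq q_inj).
have m12 : m = 1%N \/ m = 2%N.
  by case/orP: bcm => [/andP[_ /eqP] | /and5P[_ _ _ /eqP]]; [left | right].
have delta_chi i : delta i = if m == 1%N then chi8 true false (q i) else chi8 false true (q i).
  rewrite /delta; case: m12 => -> /=; first exact: quad_char_N1.
  exact: quad_char_N2.
have co_q8 i : coprime (q i) 8 by rewrite coprime_sym.
have delta_sign i : delta i = 1 \/ delta i = -1.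
  by rewrite delta_chi; case: ifP => _; apply: realchar_coprime (chi8_real _ _) _.
have compat : nonprincipal (chi8 b c) \/
    chi8 b c =1 trivchar 8 /\ \prod_i delta i = 1.
  case: (boolP (b || c)) bcm => [bc _ | _ /= ].
    left; case: b bc kappaE => [_ _ | /= -> _]; first by exists 3.
    by exists 5.
  case/and5P => /negbTE-> /negbTE-> _ /eqP m2 /eqP chi1; right; split.
    move=> a; rewrite /trivchar -coprime_modl /chi8.
    by have := ltn_pmod a (isT : 0 < 8)%N; case: (a %% 8)%N => [|[|[|[|[|[|[|[|]]]]]]]].
  rewrite -[RHS]chi1 /n' (realchar_prodE _ _ (chi8_real _ _)).
  by apply: eq_bigr => i _; rewrite delta_chi m2.
have q_gt0 i : (0 < q i)%N by rewrite prime_gt0.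
have [s [[s_gt0 sq_s] co_s psi_s chi_s]] := exists_squarefree_in_class
  (isT : 0 < 8)%N q_gt0 co8q coq (chi8_real b c)
  (fun i => legendre_real (q_pr i) (q_odd i))
  (fun i => legendre_nonprincipal (q_pr i) (q_odd i)) delta_sign compat.
rewrite -/n' in co_s.
have [co_s8 co_sn'] : coprime s 8 /\ coprime s n'.
  by apply/andP; rewrite -coprimeMr.
have odd_s : odd s by move: co_s8; rewrite (@coprime_pexpr 3 s 2) // coprimen2.
have n'_gt0 : (0 < n')%N by rewrite prodn_gt0.
have odd_n' : odd n'.
  by rewrite -coprime2n; apply: (big_ind (coprime 2)) => [|x y hx hy|i _];
    rewrite ?coprimen1 ?coprimeMr ?hx // coprime2n.
have prime_n' p : prime p -> (p %| n')%N -> exists i, p = q i.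
  move=> p_pr; rewrite /n'; apply: (big_ind (fun x => (p %| x)%N -> exists i, p = q i)).
  - by rewrite dvdn1 => /eqP p1; rewrite p1 in p_pr.
  - by move=> x y hx hy; rewrite Euclid_dvdM // => /orP[].
  - by move=> i _; rewrite dvdn_prime2 // => /eqP->; exists i.
have sq_mul2 k : odd k -> squarefree k -> squarefree (2 * k).
  move=> odd_k sq_k p p_pr; apply/negP => p2.
  have [p2E | p_neq2] := eqVneq p 2%N.
    by move: p2; rewrite p2E -mulnn dvdn_pmul2l // dvdn2 odd_k.
  case/negP: (sq_k p p_pr); rewrite -(Gauss_dvdr _ (_ : coprime _ 2)) //.
  by rewrite coprimeXl // prime_coprime // dvdn_prime2.
have sq_n' : squarefree n'.
  move=> p p_pr; apply/negP => p2.
  have [|i pE] := prime_n' p p_pr; first by apply: dvdn_trans p2; rewrite dvdn_exp.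
  move: p2; rewrite /n' (bigD1 i) //= pE -mulnn dvdn_pmul2l // => q_dvd.
  suff : coprime (q i) (\prod_(j | j != i) q j).
    by rewrite prime_coprime // q_dvd.
  apply: (big_ind (coprime (q i))) => [|x y hx hy|j ji]; rewrite ?coprimen1 //.
    by rewrite coprimeMr hx.
  by rewrite coq // eq_sym.
have two_local (a : int) : exists x : int, (2 %| x ^+ 2 + a)%Z.
  exists a; apply/dvdzP.
  have [k [aE | aE]] : exists k : int, a = 2 * k \/ a = 2 * k + 1.
  - by exists (a %/ 2)%Z; lia.
  - by exists (k * (2 * k + 1)); rewrite aE; ring.
  - by exists ((2 * k + 1) * (k + 1)); rewrite aE; ring.
have loc_s p : prime p -> (p %| s)%N ->
    exists x : int, (p %| x ^+ 2 + (g * n')%N%:Z)%Z.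
  move=> p_pr p_s; have chi_p := chi_s p p_pr p_s.
  have co_pN := coprime_dvdl p_s co_s.
  have [co_p8 co_pn'] : coprime p 8 /\ coprime p n'.
    by apply/andP; rewrite -coprimeMr.
  have odd_p : odd p by move: co_p8; rewrite (@coprime_pexpr 3 p 2) // coprimen2.
  have sqrt_chi : sqrt_character (8 * n')
      (charprod (chi8 b c) (fun i => legendre (q i)))
      (disc8 b c * \prod_i pstar (q i)).
    apply: sqrt_character_mul; first exact: sqrt_character8.
    by apply: sqrt_character_prod => i; apply: sqrt_character_legendre.
  have kE : disc8 b c
      * \prod_i pstar (q i) = - (g * n')%N%:Z.
    rewrite /pstar big_split /=.
    under eq_bigr => i _ do rewrite quad_char_N1 //.
    rewrite -(realchar_prodE _ _ (chi8_real _ _)) mulrA kappaE PoszM mulNr.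
    by congr (- (_ * _)); rewrite /n' -[LHS](rmorph_prod Posz).
  rewrite kE in sqrt_chi.
  have [] := @quad_char_eq1 p (- (g * n')%N%:Z) p_pr; last first.
    by move=> x hx; exists x; rewrite opprK in hx.
  rewrite -chi_p; apply: (sqrt_character_reciprocity sqrt_chi) => //.
  - by rewrite muln_gt0.
  - rewrite dvdzE abszN /= Euclid_dvdM // negb_or -!prime_coprime // co_pn' andbT.
    by case/orP: g12 => /eqP->; rewrite ?coprimen1 ?coprimen2.
  - by left.
have loc_n p : prime p -> (p %| g * n')%N ->
    exists x : int, (p %| x ^+ 2 + (m * s)%N%:Z)%Z.
  move=> p_pr; rewrite Euclid_dvdM // => /orP[p_g | p_n'].
    have -> : p = 2%N by move: p_g; case/orP: g12 => /eqP->; rewrite ?dvdn1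
       ?dvdn_prime2 // => /eqP // p1; rewrite p1 in p_pr.
    exact: two_local.
  have [i pE] := prime_n' p p_pr p_n'; rewrite {}pE in p_pr p_n' *.
  have [] := @quad_char_eq1 (q i) (- (m * s)%N%:Z) p_pr; last first.
    by move=> x hx; exists x; rewrite opprK in hx.
  rewrite PoszM -mulNr rmorphM /= (quad_charM (odd_F i)) -/(delta i).
  rewrite -[quad_char _]/(legendre (q i) s) psi_s.
  by case: (delta_sign i) => ->.
apply: (@sum3sq_of_local_squares (g * n') (m * s)) => //.
- by rewrite muln_gt0 n'_gt0; case/orP: g12 => /eqP->.
- by rewrite muln_gt0 s_gt0; case: m12 => ->.
- rewrite coprimeMl !coprimeMr (coprime_sym n' s) co_sn' andbT.
  case/orP: g12 => /eqP gE; rewrite gE ?coprime1n ?coprime2n ?odd_s ?andbT /=.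
    by case: m12 => ->; rewrite ?coprimen1 ?coprimen2.
  case/orP: bcm => [/andP[_ /eqP->] | /and5P[_ _]]; first by rewrite coprimen1.
  by rewrite gE.
- by case/orP: g12 => /eqP->; rewrite ?mul1n //; apply: sq_mul2.
- by case: m12 => ->; rewrite ?mul1n //; apply: sq_mul2.
- move=> p p_pr; rewrite Euclid_dvdM // => /orP[p_m | ]; last exact: loc_s.
  have -> : p = 2%N by move: p_m; case: m12 => ->; rewrite ?dvdn1
       ?dvdn_prime2 // => /eqP // p1; rewrite p1 in p_pr.
  exact: two_local.
Qed.

Lemma odd_squarefree_prod n : odd n -> squarefree n ->
  exists (r : nat) (q : 'I_r -> nat), [/\ forall i, prime (q i),
    forall i, odd (q i), injective q & n = (\prod_i q i)%N].
Proof.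
move=> odd_n sq_n; have n_gt0 := odd_gt0 odd_n.
pose q (i : 'I_(size (primes n))) := nth 0%N (primes n) i.
have q_in i : q i \in primes n by rewrite mem_nth.
have q_dvd i : prime (q i) /\ (q i %| n)%N.
  by have := q_in i; rewrite mem_primes => /and3P[].
exists (size (primes n)), q; split=> [i|i|i j /eqP|].
- by case: (q_dvd i).
- by have [_ q_n] := q_dvd i; apply: dvdn_odd q_n odd_n.
- by rewrite nth_uniq ?primes_uniq // => /eqP/val_inj.
rewrite {1}(prod_prime_decomp n_gt0) prime_decompE big_map /=.
rewrite (big_nth 0%N) big_mkord; apply: eq_bigr => i _.
rewrite -/(q i); have [q_pr q_n] := q_dvd i.
suff -> : logn (q i) n = 1%N by [].
have := sq_n _ q_pr; rewrite pfactor_dvdn // -leqNgt => log_le.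
by apply/eqP; rewrite eqn_leq log_le logn_gt0 q_in.
Qed.

Lemma sum3sq_squarefree n : (0 < n)%N -> squarefree n ->
    (n %% 4 == 1)%N || (n %% 4 == 2)%N || (n %% 8 == 3)%N ->
  exists u v w : int, n%:Z = u ^+ 2 + v ^+ 2 + w ^+ 2.
Proof.
move=> n_gt0 sq_n n_mod; have [odd_n | even_n] := boolP (odd n).
  have [r [q [q_pr q_odd q_inj nE]]] := odd_squarefree_prod odd_n sq_n.
  have n_mod8 : (n %% 8)%N \in [:: 1; 5; 3]%N.
    by rewrite !inE; move: n_mod odd_n; clear; lia.
  rewrite -(mul1n n) nE; move: n_mod8; rewrite !inE => n_mod8.
  have [n3 | n_neq3] := eqVneq (n %% 8)%N 3%N.
    apply: (@sum3sq_of_class r q false false 1 2) => //; rewrite -nE /chi8 n3 //.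
  apply: (@sum3sq_of_class r q true false 1 1) => //; rewrite -nE /chi8.
  by move: n_mod8; rewrite (negbTE n_neq3) orbF => /orP[] /eqP->.
pose n' := (n %/ 2)%N.
have n2 : n = (2 * n')%N by rewrite /n'; move: even_n; clear; lia.
have odd_n' : odd n' by move: n_mod even_n; rewrite n2; clear; lia.
have sq_n' : squarefree n'.
  by move=> p p_pr; apply: contra (sq_n p p_pr); rewrite n2; apply: dvdn_mull.
have [r [q [q_pr q_odd q_inj n'E]]] := odd_squarefree_prod odd_n' sq_n'.
have n'_mod8 : (n' %% 8)%N \in [:: 1; 5; 3; 7]%N.
  by rewrite !inE; move: odd_n'; clear; lia.
rewrite n2 n'E; move: n'_mod8; rewrite !inE; case/or4P => /eqP n8.
- by apply: (@sum3sq_of_class r q false true 2 1) => //; rewrite -n'E /chi8 n8.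
- by apply: (@sum3sq_of_class r q false true 2 1) => //; rewrite -n'E /chi8 n8.
- by apply: (@sum3sq_of_class r q true true 2 1) => //; rewrite -n'E /chi8 n8.
- by apply: (@sum3sq_of_class r q true true 2 1) => //; rewrite -n'E /chi8 n8.
Qed.

(** An odd square is 1 modulo 8, so square factors can be removed without leaving
    the residue classes considered. *)
Theorem sum3sq n :
    (n %% 4 == 1)%N || (n %% 4 == 2)%N || (n %% 8 == 3)%N ->
  exists u v w : int, n%:Z = u ^+ 2 + v ^+ 2 + w ^+ 2.
Proof.
have [n0] := ubnP n; elim: n0 => // n0 IH in n *; move=> lt_n n_mod.
have n_gt0 : (0 < n)%N by case: (n) n_mod.
have [sq_n | [p [p_pr /dvdnP[k nE]]]] := squarefreeP n_gt0.
  exact: sum3sq_squarefree.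
have odd_p : odd p.
  apply: contraT; rewrite -dvdn2 => /dvdnP[j pE].
  have n4 : n = (k * j * j * 4)%N by rewrite nE pE -mulnn; ring.
  by move: n_mod; rewrite n4 modnMl; clear; lia.
have p2_mod8 : (p ^ 2 %% 8 = 1)%N.
  rewrite -modnXm; have : (p %% 8)%N \in [:: 1; 3; 5; 7]%N.
    by rewrite !inE; move: odd_p; clear; lia.
  by rewrite !inE => /or4P[] /eqP->.
have k_mod : (n %% 8 = k %% 8)%N by rewrite nE -modnMmr p2_mod8 muln1.
have [||u [v [w kE]]] := IH k.
- apply: (@leq_trans n) => //; move: n_gt0.
  rewrite nE muln_gt0 => /andP[k_gt0 _].
  by rewrite ltn_Pmulr // -(exp1n 2) ltn_exp2r ?prime_gt1.
- by move: n_mod k_mod; clear; lia.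
exists (u * p), (v * p), (w * p); rewrite nE PoszM kE -mulnn PoszM; ring.
Qed.

(** * Representations with a square linear form *)

(** The variables x, y, z, w stand for 13 times the four rational numbers. *)
Definition represented (m : int) := exists x y z w t : int,
  [/\ [/\ 0 <= x, 0 <= y, 0 <= z & 0 <= w],
      169 * m = x ^+ 2 + y ^+ 2 + z ^+ 2 + w ^+ 2
    & x + 2 * y + 2 * z = 13 * t ^+ 2].

(** Reflection in (2, -2, 1, -2), an integral vector of norm 13 orthogonal to
    (1, 2, 2, 0). It keeps u = x + 2y + 2z and a, and replaces the pair (b, 3w)
    by its image under a plane reflection of matrix (-5 12; 12 5) / 13, so that
    b < 0 <= w gives a positive B / 13 in place of b. The inequality
    5 m <= u^2 amounts to 5 (a^2 + b^2 + 9 w^2) <= 4 u^2; then Y >= 0 follows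
    from the Cauchy-Schwarz inequality for (2, -1) and (B, 13 a), and X >= 0 from
    a^2 <= b^2 when a is negative too. *)
Lemma reflect_to_orthant (x y z w m t : int) :
    m = x ^+ 2 + y ^+ 2 + z ^+ 2 + w ^+ 2 -> x + 2 * y + 2 * z = t ^+ 2 ->
    5 * m <= t ^+ 4 -> 2 * x - 2 * y + z < 0 ->
    2 * x - 2 * y + z <= 2 * x + y - 2 * z ->
  represented m.
Proof.
move=> mE uE le_mt b_lt0 b_le_a.
wlog w_ge0 : w mE / 0 <= w.
  move=> W; have [|/ltW w_le0] := leP 0 w; first exact: W.
  by apply: (W (- w)); rewrite ?oppr_ge0 ?sqrrN.
pose u := t ^+ 2; have u_ge0 : 0 <= u := sqr_ge0 t.
rewrite -/u in uE.
have {}le_mt : 5 * m <= u ^+ 2 by rewrite -exprM.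
pose a := 2 * x + y - 2 * z; pose b := 2 * x - 2 * y + z.
rewrite -/a -/b in b_lt0 b_le_a.
have le_u : 5 * (a ^+ 2 + b ^+ 2 + 9 * w ^+ 2) <= 4 * u ^+ 2.
  have : 9 * m = u ^+ 2 + (a ^+ 2 + b ^+ 2 + 9 * w ^+ 2).
    by rewrite mE -uE /a /b; ring.
  by move: le_mt; clear; lia.
pose B := 36 * w - 5 * b.
have B_gt0 : 0 < B by rewrite /B; move: b_lt0 w_ge0; clear; lia.
have le_a2 : 5 * a ^+ 2 <= 4 * u ^+ 2.
  by move: le_u (sqr_ge0 b) (sqr_ge0 w); clear; lia.
have le_a : a <= u by move: le_a2 u_ge0; clear; nia.
pose X := 13 * x - 4 * b + 8 * w; pose Y := 13 * y + 4 * b - 8 * w.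
pose Z := 13 * z - 2 * b + 4 * w; pose W := `|4 * b + 5 * w|.
have X9 : 9 * X = 13 * u + 26 * a + 2 * B by rewrite -uE /X /B /a /b; ring.
have Y9 : 9 * Y = 26 * u + 13 * a - 2 * B by rewrite -uE /Y /B /a /b; ring.
have Z9 : 9 * Z = 26 * u - 26 * a + B by rewrite -uE /Z /B /a /b; ring.
exists X, Y, Z, W, t; split; last first.
- by rewrite -/u -uE /X /Y /Z; ring.
- by rewrite /W real_normK ?num_real // mE /X /Y /Z /a /b; ring.
split; last exact: normr_ge0.
- have [a_ge0 | a_lt0] := leP 0 a.
    by move: X9 a_ge0 B_gt0 u_ge0; clear; lia.
  have : - (16 * a) <= 13 * u.
    have : 10 * a ^+ 2 <= 4 * u ^+ 2.
      have : a ^+ 2 <= b ^+ 2.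
        by rewrite -(sqrrN a) -(sqrrN b) ler_sqr ?nnegrE; move: a_lt0 b_lt0 b_le_a; clear; lia.
      by move: le_u (sqr_ge0 w); clear; lia.
    by move: a_lt0 u_ge0; clear; nia.
  by move: X9 b_le_a b_lt0 a_lt0 w_ge0; rewrite /B; clear; lia.
- have u26_ge0 : 0 <= 26 * u by rewrite mulr_ge0 // u_ge0.
  suff : 2 * B - 13 * a <= 26 * u by move: Y9; clear; lia.
  have [neg | pos] := leP (2 * B - 13 * a) 0.
    exact: le_trans neg u26_ge0.
  rewrite -ler_sqr ?nnegrE // ?(ltW pos) //.
  (* The gaps are (B + 26 a)^2 here and (12 b + 15 w)^2 in the next bound. *)
  have h1 : (2 * B - 13 * a) ^+ 2 <= 5 * (B ^+ 2 + 169 * a ^+ 2).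
    have := sqr_ge0 (B + 26 * a).
    rewrite -subr_ge0 => h; rewrite -subr_ge0.
    rewrite (_ : _ - _ = (B + 26 * a) ^+ 2 - 0) //; ring.
  have h2 : B ^+ 2 <= 169 * (b ^+ 2 + 9 * w ^+ 2).
    have := sqr_ge0 (12 * b + 15 * w); rewrite -subr_ge0 => h; rewrite -subr_ge0.
    by rewrite (_ : _ - _ = (12 * b + 15 * w) ^+ 2 - 0) // /B; ring.
  rewrite (_ : (26 * u) ^+ 2 = 676 * u ^+ 2); last by ring.
  move: h1 h2 le_u; move: ((2 * B - _) ^+ 2) (B ^+ 2) (a ^+ 2) (b ^+ 2) (w ^+ 2) (u ^+ 2).
  by clear; lia.
- by clear -Z9 le_a B_gt0; clearbody Z B a u; lia.
Qed.

(** Exchanging y and z exchanges a and b, so the reflection can be applied to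
    whichever of a and b is smaller; if neither is negative, x, y, z already
    lie in the positive orthant. *)
Lemma represented_of_signed (x y z w m t : int) :
    m = x ^+ 2 + y ^+ 2 + z ^+ 2 + w ^+ 2 -> x + 2 * y + 2 * z = t ^+ 2 ->
    5 * m <= t ^+ 4 ->
  represented m.
Proof.
move=> mE uE le_mt; pose a := 2 * x + y - 2 * z; pose b := 2 * x - 2 * y + z.
have swap : a < 0 -> a <= b -> represented m.
  move=> a_lt0 le_ab; apply: (@reflect_to_orthant x z y w m t) => //.
  - by rewrite mE; ring.
  - by rewrite -uE; ring.
  - by move: a_lt0; rewrite /a; clear; lia.
  - by move: le_ab; rewrite /a /b; clear; lia.
have [b_lt0 | b_ge0] := ltP b 0.
  have [le_ba | /ltW le_ab] := leP b a.
    exact: reflect_to_orthant mE uE le_mt b_lt0 le_ba.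
  have a_lt0 := le_lt_trans le_ab b_lt0.
  exact: swap.
have [a_lt0 | a_ge0] := ltP a 0.
  have le_ab := ltW (lt_le_trans a_lt0 b_ge0).
  exact: swap.
pose u := t ^+ 2; have u_ge0 : 0 <= u := sqr_ge0 t; rewrite -/u in uE.
have {}le_mt : 5 * m <= u ^+ 2 by rewrite -exprM.
have le_u : 5 * (a ^+ 2 + b ^+ 2) <= 4 * u ^+ 2.
  have : 9 * m = u ^+ 2 + (a ^+ 2 + b ^+ 2 + 9 * w ^+ 2).
    by rewrite mE -uE /a /b; ring.
  by move: le_mt (sqr_ge0 w); clear; lia.
have le_a : a <= u by move: le_u (sqr_ge0 b) u_ge0; clear; nia.
have le_b : b <= u by move: le_u (sqr_ge0 a) u_ge0; clear; nia.
have : [/\ 0 <= x, 0 <= y & 0 <= z].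
  by move: a_ge0 b_ge0 le_a le_b u_ge0 uE; rewrite /a /b; clear; split; lia.
case=> x_ge0 y_ge0 z_ge0; exists (13 * x), (13 * y), (13 * z), (13 * `|w|), t.
split; first by rewrite !mulr_ge0.
- by rewrite !exprMn real_normK ?num_real // mE; ring.
- by rewrite -/u -uE; ring.
Qed.

(** The last class consists of 4 times the integers that are 2 modulo 4. *)
Definition sum3sq_residue (n : nat) :=
  [|| n %% 4 == 1, n %% 4 == 2, n %% 8 == 3 | n %% 16 == 8]%N.

Lemma sum3sq_of_residue n : sum3sq_residue n ->
  exists u v w : int, n%:Z = u ^+ 2 + v ^+ 2 + w ^+ 2.
Proof.
rewrite /sum3sq_residue orbA orbA => /orP[|n8]; first exact: sum3sq.
have [k nE] : exists k, n = (4 * k)%N by exists (n %/ 4)%N; move: n8; clear; lia.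
have [|u [v [w kE]]] := @sum3sq k; first by move: n8; rewrite nE; clear; lia.
by exists (2 * u), (2 * v), (2 * w); rewrite nE PoszM kE; ring.
Qed.

Lemma sqr_class3 (a : int) : exists i : int,
  a ^+ 2 = (3 * i) ^+ 2 \/ a ^+ 2 = (3 * i - 1) ^+ 2.
Proof.
pose q := (a %/ 3)%Z.
have [aE | [aE | aE]] : a = 3 * q \/ a = 3 * q + 1 \/ a = 3 * q + 2.
- by rewrite /q; clear; lia.
- by exists q; left; rewrite -aE.
- by exists (- q); right; rewrite aE; ring.
- by exists (q + 1); right; rewrite aE; ring.
Qed.

(** Squares modulo 3 are 0 and 1, so a sum of three squares that is 2 modulo 3
    has exactly one term divisible by 3. *)
Lemma two_units3 (a b c k : int) : a ^+ 2 + b ^+ 2 + c ^+ 2 = 3 * k + 2 ->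
  exists i j w : int, a ^+ 2 + b ^+ 2 + c ^+ 2
    = (3 * i - 1) ^+ 2 + (3 * j - 1) ^+ 2 + 9 * w ^+ 2.
Proof.
have sq0 (i : int) : (3 * i) ^+ 2 = 9 * i ^+ 2 by ring.
have sq1 (i : int) : (3 * i - 1) ^+ 2 = 9 * i ^+ 2 - 6 * i + 1 by ring.
have [i hi] := sqr_class3 a; have [j hj] := sqr_class3 b.
have [l hl] := sqr_class3 c.
case: hi => ->; case: hj => ->; case: hl => ->; rewrite ?sq0 ?sq1 => sumE.
- by exfalso; move: sumE; clear; lia.
- by exfalso; move: sumE; clear; lia.
- by exfalso; move: sumE; clear; lia.
- by exists j, l, i; rewrite !sq1; ring.
- by exfalso; move: sumE; clear; lia.
- by exists i, l, j; rewrite !sq1; ring.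
- by exists i, j, l; rewrite !sq1; ring.
- by exfalso; move: sumE; clear; lia.
Qed.

(** Two of three integers have the same square modulo 3. *)
Lemma opposite_pair3 (a b c : int) : exists a' b' c' e : int,
  a ^+ 2 + b ^+ 2 + c ^+ 2 = a' ^+ 2 + b' ^+ 2 + c' ^+ 2 /\ a' + b' = 3 * e.
Proof.
have same (f : int -> int) i j : f i - f j = 3 * (i - j) -> forall x : int,
    exists a' b' c' e : int,
    f i ^+ 2 + f j ^+ 2 + x ^+ 2 = a' ^+ 2 + b' ^+ 2 + c' ^+ 2 /\ a' + b' = 3 * e.
  move=> fij x; exists (f i), (- f j), x, (i - j).
  by rewrite sqrrN.
have same0 i j : 3 * i - 3 * j = 3 * (i - j) :> int by ring.
have same1 i j : (3 * i - 1) - (3 * j - 1) = 3 * (i - j) :> int by ring.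
have [i hi] := sqr_class3 a; have [j hj] := sqr_class3 b.
have [l hl] := sqr_class3 c.
case: hi => ->; case: hj => ->.
- exact: (same (fun i => 3 * i)).
- case: hl => ->.
    by rewrite addrAC; exact: (same (fun i => 3 * i)).
  by rewrite -addrA addrC; exact: (same (fun i => 3 * i - 1)).
- case: hl => ->.
    by rewrite -addrA addrC; exact: (same (fun i => 3 * i)).
  by rewrite addrAC; exact: (same (fun i => 3 * i - 1)).
- exact: (same (fun i => 3 * i - 1)).
Qed.

(** If t = 3 k, then m - 9 k^4 = a^2 + b^2 + c^2 with a + b = 3 e, and the vector
    (k^2 + 2 e, 2 k^2 + e - b, 2 k^2 + e - a, c) is integral. Otherwise
    t^2 = 1 modulo 3 and 9m - t^4 = 2 modulo 3; choosing the two squares prime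
    to 3 to be those of integers that are -1 modulo 3, the fact that
    t^4 + a^2 + b^2 is divisible by 9 is enough to make x, y, z integral. *)
Lemma signed_representation (m t : nat) : (t ^ 4 <= 9 * m)%N ->
    sum3sq_residue (9 * m - t ^ 4) ->
  exists x y z w : int, m%:Z = x ^+ 2 + y ^+ 2 + z ^+ 2 + w ^+ 2 /\
    x + 2 * y + 2 * z = t%:Z ^+ 2.
Proof.
move=> le_tm res_n.
have t4E : (t ^ 4)%N%:Z = t%:Z ^+ 4 by rewrite -[LHS]natz natrX natz.
have [/dvdnP[k tE] | t_neq0] := boolP (3 %| t)%N.
  have t4 : (t ^ 4 = 81 * k ^ 4)%N by rewrite tE expnMn mulnC.
  have k4E : (k ^ 4)%N%:Z = k%:Z ^+ 4 by rewrite -[LHS]natz natrX natz.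
  rewrite t4 in le_tm res_n.
  have [|u [v [w uvw]]] := @sum3sq_of_residue (m - 9 * k ^ 4).
    move: le_tm res_n; rewrite /sum3sq_residue; move: (k ^ 4)%N => K; clear; lia.
  have [a [b [c [e [eq_sq abE]]]]] := opposite_pair3 u v w.
  have aE : a = 3 * e - b by rewrite -abE addrK.
  exists (k%:Z ^+ 2 + 2 * e), (2 * k%:Z ^+ 2 + e - b), (2 * k%:Z ^+ 2 + e - a), c.
  rewrite tE PoszM; split; last first.
    by rewrite aE; ring.
  have -> : m%:Z = 9 * k%:Z ^+ 4 + (m - 9 * k ^ 4)%N%:Z.
    by rewrite -k4E; move: le_tm; move: (k ^ 4)%N => K; clear; lia.
  by rewrite uvw eq_sq aE; ring.
have [k t2E] : exists k : int, t%:Z ^+ 2 = 3 * k + 1.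
  have [q [tE | tE]] : exists q : int, t%:Z = 3 * q + 1 \/ t%:Z = 3 * q + 2.
  - by exists (t %/ 3)%N%:Z; move: t_neq0; clear; lia.
  - by exists (3 * q ^+ 2 + 2 * q); rewrite tE; ring.
  - by exists (3 * q ^+ 2 + 4 * q + 1); rewrite tE; ring.
have [u [v [c uvw]]] := sum3sq_of_residue res_n.
have nE : (9 * m - t ^ 4)%N%:Z = 9 * m%:Z - (3 * k + 1) ^+ 2.
  rewrite -t2E -exprM -t4E; move: le_tm; move: (t ^ 4)%N => T; clear; lia.
have [|i [j [w ijw]]] := @two_units3 u v c (3 * m%:Z - 3 * k ^+ 2 - 2 * k - 1).
  by rewrite -uvw nE; ring.
rewrite -uvw nE in ijw.
have [g kE] : exists g : int, k = 3 * g + 1 + i + j.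
  (* Dividing the equation for 9m by 3 shows that k - i - j = 1 modulo 3. *)
  pose S := m%:Z - k ^+ 2 - i ^+ 2 - j ^+ 2 - w ^+ 2.
  have S3 : 3 * S = 2 * (k - i - j) + 1.
    suff : 3 * (3 * S) = 3 * (2 * (k - i - j) + 1) by clear; lia.
    by rewrite (_ : 3 * (3 * S) = (9 * m%:Z - (3 * k + 1) ^+ 2)
      - ((3 * i - 1) ^+ 2 + (3 * j - 1) ^+ 2 + 9 * w ^+ 2)
      + 3 * (2 * (k - i - j) + 1)); [rewrite ijw subrr add0r | rewrite /S; ring].
  exists ((S - 1) %/ 2)%Z; move: S3; move: S => S; clear; lia.
exists (g + i + j), (2 * g + 1 + i), (2 * g + 1 + j), w; split.
  have : 9 * m%:Z = (3 * k + 1) ^+ 2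
      + ((3 * i - 1) ^+ 2 + (3 * j - 1) ^+ 2 + 9 * w ^+ 2).
    by rewrite -ijw addrC subrK.
  rewrite kE => h; suff : 9 * m%:Z = 9 * ((g + i + j) ^+ 2 + (2 * g + 1 + i) ^+ 2
    + (2 * g + 1 + j) ^+ 2 + w ^+ 2) by clear; lia.
  by rewrite h; ring.
by rewrite t2E kE; ring.
Qed.

Lemma represented_of_window (m t : nat) : (5 * m <= t ^ 4 <= 9 * m)%N ->
  sum3sq_residue (9 * m - t ^ 4) -> represented m.
Proof.
case/andP=> le_mt le_tm res_n.
have [x [y [z [w [mE tE]]]]] := signed_representation le_tm res_n.
apply: represented_of_signed mE tE _.
by rewrite -[t%:Z ^+ 4](_ : (t ^ 4)%N%:Z = _); [lia | rewrite -[LHS]natz natrX natz].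
Qed.

(** * Choice of the linear form, and small integers *)

Definition root_parity (m : nat) : bool :=
  ~~ [|| m %% 4 == 1, m %% 4 == 2 | m %% 16 == 8]%N.

(** t^4 is 0 or 1 modulo 16 according to the parity of t. *)
Lemma root_parity_residue m t : ~~ (16 %| m)%N -> (t ^ 4 <= 9 * m)%N ->
  odd t = root_parity m -> sum3sq_residue (9 * m - t ^ 4).
Proof.
move=> m16 le_tm odd_t.
have t4 : (t ^ 4 %% 16 = odd t)%N.
  rewrite -modnXm; have := ltn_pmod t (isT : 0 < 16)%N.
  have -> : odd t = odd (t %% 16) by rewrite odd_mod.
  by move: (t %% 16)%N => r; do 16?[case: r => [//|r]].
move: t4 le_tm m16; rewrite odd_t /root_parity /sum3sq_residue.
move: (t ^ 4)%N => T; clear; case E: [|| _, _ | _] => /=; lia.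
Qed.

(** The largest t of the given parity with t^4 <= 9m satisfies 9m < (t + 2)^4,
    and 5 (t + 2)^4 <= 9 t^4 for t >= 13; t >= 13 is ensured by 14^4 <= 9m. *)
Lemma large_window m (b : bool) : (4269 <= m)%N ->
  exists t, odd t = b /\ (5 * m <= t ^ 4 <= 9 * m)%N.
Proof.
move=> le_m; pose P t := (odd t == b) && (t ^ 4 <= 9 * m)%N.
pose t0 := if b then 13%N else 14%N.
have Pt0 : P t0 by rewrite /P /t0; case: b {P t0}; move: le_m; clear; lia.
have P_le t : P t -> (t <= 9 * m)%N.
  move=> /andP[_]; apply: leq_trans; case: t => // t.
  by rewrite -[leqLHS]expn1 leq_pexp2l.
have := ex_maxnP (ex_intro P t0 Pt0) P_le.
case=> t /andP[/eqP odd_t le_tm] t_max; exists t; split=> //; rewrite le_tm andbT.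
have t_ge : (13 <= t)%N by apply: leq_trans (t_max _ Pt0); rewrite /t0; case: (b).
have : ~~ P t.+2 by apply/negP => /t_max; lia.
rewrite /P /= negbK odd_t eqxx /= -ltnNge => lt_mt.
suff : (5 * t.+2 ^ 4 <= 9 * t ^ 4)%N by move: lt_mt; clear; lia.
have [k ->] : exists k, t = (13 + k)%N by exists (t - 13)%N; rewrite subnKC.
by rewrite -addn2; clear; nia.
Qed.

(** The searches use conditionals in place of boolean disjunctions so that
    evaluation by value stops at the first success. *)
Fixpoint any_up (fuel : nat) (k : N) (P : N -> bool) : bool :=
  if P k then true else
  if fuel is fuel'.+1 then any_up fuel' (N.succ k) P else false.

Fixpoint any_down (fuel : nat) (k : N) (P : N -> bool) : bool :=
  if P k then true else
  if fuel is fuel'.+1 then any_down fuel' (N.pred k) P else false.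

Fixpoint all_up (fuel : nat) (k : N) (P : N -> bool) : bool :=
  if P k then if fuel is fuel'.+1 then all_up fuel' (N.succ k) P else true
  else false.

Lemma any_upP fuel k P : any_up fuel k P -> exists x, P x.
Proof.
by elim: fuel k => [|f IH] k /=; case Pk: (P k) => //; [exists k | exists k | exact: IH].
Qed.

Lemma any_downP fuel k P : any_down fuel k P -> exists x, P x.
Proof.
by elim: fuel k => [|f IH] k /=; case Pk: (P k) => //; [exists k | exists k | exact: IH].
Qed.

Lemma all_upP fuel k P : all_up fuel k P ->
  forall n, (n <= fuel)%N -> P (N.add (N.of_nat n) k).
Proof.
elim: fuel k => [|f IH] k /=; case Pk: (P k) => //.
  by move=> _ n; rewrite leqn0 => /eqP->.
move=> /IH all_f [|n] le_n; first exact: Pk.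
by have := all_f n le_n; rewrite N.add_succ_r -N.add_succ_l -Nnat.Nat2N.inj_succ.
Qed.

(** For m <= 4268, 9m < 15^4, whence the range of t. *)
Definition in_window (m : N) : bool :=
  let b := negb (orb (orb (N.eqb (N.modulo m 4) 1) (N.eqb (N.modulo m 4) 2))
                     (N.eqb (N.modulo m 16) 8)) in
  any_up 14 0 (fun t => let t4 := N.mul (N.mul t t) (N.mul t t) in
    if N.leb (N.mul 5 m) t4 then
      if N.leb t4 (N.mul 9 m) then Bool.eqb (N.odd t) b else false
    else false).

(** By symmetry only z <= y is tried, and h - y is the largest z with x >= 0. *)
Definition integral_search (m : N) : bool :=
  any_down 14 14 (fun t => let u := N.mul t t in
    if N.leb (N.mul u u) (N.mul 9 m) then
      let h := N.div2 u in
      any_down (N.to_nat h) h (fun y =>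
        any_up (N.to_nat (N.min y (N.sub h y))) 0 (fun z =>
          let s := N.mul 2 (N.add y z) in let x := N.sub u s in
          let q := N.add (N.mul x x) (N.add (N.mul y y) (N.mul z z)) in
          if N.leb q m then
            let r := N.sub m q in
            if N.eqb (N.mul (N.sqrt r) (N.sqrt r)) r then N.leb s u else false
          else false))
    else false).

(** Each of the five exceptional integers needs a proper denominator 13. *)
Definition small_case (m : N) : bool :=
  if N.eqb (N.modulo m 16) 0 then true else if in_window m then true else
  if has (N.eqb m) [:: 7; 24; 55; 120; 255]%num then true else
  integral_search m.

Lemma small_cases : all_up 4268 0 small_case.
Proof. by vm_compute. Qed.

Lemma leb_of_nat a b : N.leb (N.of_nat a) (N.of_nat b) = (a <= b)%N.
Proof. by apply/idP/idP => [/N.leb_le | le_ab]; [lia | apply/N.leb_le; lia]. Qed.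

Lemma odd_of_nat n : N.odd (N.of_nat n) = odd n.
Proof.
elim: n => // n IHn.
by rewrite Nnat.Nat2N.inj_succ N.odd_succ -N.negb_odd IHn.
Qed.

Lemma eqb_mod_of_nat m d r : (0 < d)%N ->
  N.eqb (N.modulo (N.of_nat m) (N.of_nat d)) (N.of_nat r) = (m %% d == r)%N.
Proof.
move=> d_gt0; rewrite -(N.mod_unique _ _ (N.of_nat (m %/ d)) (N.of_nat (m %% d))).
- by apply/idP/idP; lia.
- by have := ltn_pmod m d_gt0; lia.
- rewrite -Nnat.Nat2N.inj_mul -Nnat.Nat2N.inj_add; congr N.of_nat.
  by rewrite [LHS](divn_eq m d) mulnC.
Qed.

Lemma in_windowP m : in_window (N.of_nat m) -> exists t,
  odd t = root_parity m /\ (5 * m <= t ^ 4 <= 9 * m)%N.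
Proof.
move=> /any_upP[t]; cbv beta zeta; rewrite -(Nnat.N2Nat.id t); move: (N.to_nat t) => {}t.
rewrite -[4%num]/(N.of_nat 4) -[1%num]/(N.of_nat 1) -[2%num]/(N.of_nat 2).
rewrite -[16%num]/(N.of_nat 16) -[8%num]/(N.of_nat 8) !eqb_mod_of_nat //.
rewrite -[5%num]/(N.of_nat 5) -[9%num]/(N.of_nat 9) -!Nnat.Nat2N.inj_mul.
rewrite !leb_of_nat odd_of_nat; case: ifP => // le1; case: ifP => // le2.
move=> /Bool.eqb_prop odd_t; exists t; split.
  by rewrite odd_t /root_parity orbA.
have -> : (t ^ 4 = t * t * (t * t))%N by rewrite !expnS expn0; ring.
by apply/andP; split; [move: le1 | move: le2]; lia.
Qed.

Lemma integral_searchP m : integral_search m -> represented (N.to_nat m)%:Z.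
Proof.
move=> /any_downP[t]; cbv beta zeta; case: ifP => // _ /any_downP[y].
cbv beta => /any_upP[z]; cbv beta zeta; case: ifP => // /N.leb_le le_qm.
case: ifP => // /N.eqb_eq sqrt_r /N.leb_le le_su.
move: sqrt_r (N.sub_add _ _ le_qm) (N.sub_add _ _ le_su).
set x := N.sub (N.mul t t) _; set w := N.sqrt _; move: (N.sub m _) => r.
move: x w => x w; clear le_qm le_su => <- mE uE.
have {mE} mE := congr1 (fun n => (N.to_nat n)%:Z) mE.
have {uE} uE := congr1 (fun n => (N.to_nat n)%:Z) uE.
move: mE uE; rewrite !(Nnat.N2Nat.inj_add, Nnat.N2Nat.inj_mul).
rewrite !(plusE, multE) !(PoszD, PoszM) /=.
rewrite -[(PosDef.Pos.to_nat 2)%:Z]/(2 : int) => <- uE.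
have nonneg (n : N) : 0 <= (N.to_nat n)%:Z by [].
move: (nonneg x) (nonneg y) (nonneg z) (nonneg w) uE.
move: (N.to_nat x)%:Z (N.to_nat y)%:Z (N.to_nat z)%:Z (N.to_nat w)%:Z (N.to_nat t)%:Z.
clear => x y z w t x_ge0 y_ge0 z_ge0 w_ge0 uE.
exists (13 * x), (13 * y), (13 * z), (13 * w), t; split.
- by rewrite !mulr_ge0.
- by ring.
- by rewrite expr2 -uE; ring.
Qed.

Lemma represented_small m : (m <= 4268)%N -> ~~ (16 %| m)%N -> represented m%:Z.
Proof.
move=> le_m m16; have := all_upP small_cases le_m.
rewrite N.add_0_r /small_case.
rewrite -[16%num]/(N.of_nat 16) -[0%num]/(N.of_nat 0) eqb_mod_of_nat //.
rewrite -[(_ == _)%N]/(16 %| m)%N (negbTE m16).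
case: ifP => [/in_windowP[t [odd_t win]] _ | _].
  apply: (represented_of_window win); apply: root_parity_residue => //.
  by case/andP: win.
case: ifP => [exc _ | _ /integral_searchP]; last by rewrite Nnat.Nat2N.id.
have : m \in [:: 7; 24; 55; 120; 255]%N.
  move: exc; rewrite !inE /= !orbF.
  by case/or4P => [| | | /orP[]] /N.eqb_eq; lia.
rewrite !inE => /or4P[/eqP-> | /eqP-> | /eqP-> | /orP[] /eqP->].
(* The witnesses are 13 times the four rational numbers, followed by t. *)
- by exists 1, 1, 5, 34, 1.
- by exists 24, 4, 10, 58, 2.
- by exists 95, 1, 10, 13, 3.
- by exists 76, 2, 64, 102, 4.
- by exists 173, 5, 71, 90, 5.
Qed.

Lemma represented_nat m : represented m%:Z.
Proof.
have [n] := ubnP m; elim: n => // n IH in m *; move=> lt_m.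
have [/dvdnP[k mE] | m16] := boolP (16 %| m)%N; last first.
  have [le_m | lt_m'] := leqP m 4268; first exact: represented_small.
  have [t [odd_t win]] := large_window (root_parity m) lt_m'.
  apply: (represented_of_window win); apply: root_parity_residue => //.
  by case/andP: win.
have [m0 | m_gt0] := posnP m.
  by rewrite m0; exists 0, 0, 0, 0, 0.
have [|x [y [z [w [t [[x0 y0 z0 w0] kE tE]]]]]] := IH k.
  by move: lt_m m_gt0; rewrite mE; clear; lia.
exists (4 * x), (4 * y), (4 * z), (4 * w), (2 * t); split.
- by rewrite !mulr_ge0.
- by rewrite mE PoszM mulrA kE; ring.
- by transitivity (4 * (x + 2 * y + 2 * z)); [ring | rewrite tE; ring].
Qed.

Lemma nat_over_int (d : nat) (x : int) : 0 <= x -> nat_over d (x%:~R / d%:R).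
Proof. by case: x => // k _; exists k. Qed.

Theorem theorem1p6 (m : nat) :
  exists x y z w : rat,
    [/\ nat_over 13 x, nat_over 13 y, nat_over 13 z & nat_over 13 w] /\
    m%:R = x ^+ 2 + y ^+ 2 + z ^+ 2 + w ^+ 2 /\
    integer_square (x + 2 * y + 2 * z).
Proof.
have [x [y [z [w [t [[x0 y0 z0 w0] mE tE]]]]]] := represented_nat m.
exists (x%:~R / 13%:R), (y%:~R / 13%:R), (z%:~R / 13%:R), (w%:~R / 13%:R).
split; first by split; apply: nat_over_int.
have {mE} mE := congr1 (fun n : int => n%:~R : rat) mE.
have {tE} tE := congr1 (fun n : int => n%:~R : rat) tE.
rewrite /= !rmorphD !rmorphM /= in mE tE.
split; last exists t; lra.
Qed.
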